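(* Let $(H,R)$ be a semisimple quasi-triangular Hopf algebra over a field $k$ of characteristic zero, and let $A$ be a strongly separable quantum commutative left $H$-module algebra with symmetric separability idempotent $x=x^1\otimes x^2$. Let $B=A\otimes H\otimes A^*\cong\operatorname{End}A^*\otimes H$ be the weak Hopf algebra described in the context, and let $$\varphi:A\#H\to B,\qquad \varphi(a\#h)=S(h_{(1)})\cdot (x^1a)\otimes h_{(2)}\otimes (x^2\rightharpoonup\alpha_A).$$ If the Drinfeld element $u=S(R^2)R^1$ of $(H,R)$ acts trivially on $A$, then $\varphi$ is a monomorphism of weak Hopf algebras, where $A\#H$ carries the weak Hopf algebra structure described in the context.
   Context: All algebras and coalgebras are over $k$; Sweedler notation is used and $S$ is the antipode of $H$. A quasi-triangular Hopf algebra is a pair $(H,R)$, $R=R^1\otimes R^2\in H\otimes H$ invertible, with $R^1h_{(1)}\otimes R^2h_{(2)}=h_{(2)}R^1\otimes h_{(1)}R^2$ for all $h\in H$, $(\Delta\otimes id)(R)=R_1^1\otimes R_2^1\otimes R_1^2R_2^2$, $(id\otimes\Delta)(R)=R_1^1R_2^1\otimes R_2^2\otimes R_1^2$. Here $R_i=R_i^1\otimes R_i^2$ are copies of $R$ (lower index: copy; upper index: tensor leg). A left $H$-module algebra $A$ is quantum commutative if $ab=(R^2\cdot b)(R^1\cdot a)$ for all $a,b\in A$. $A$ is strongly separable if it has a symmetric separability idempotent $x=x^1\otimes x^2\in A\otimes A$, i.e. $ax^1\otimes x^2=x^1\otimes x^2a$, $x^1x^2=1_A$, $x^1\otimes x^2=x^2\otimes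 x^1$. $\alpha_A\in A^*$ is determined by $\langle\alpha_A,x^1\rangle x^2=1_A$. For $a,b\in A$, $a^*\in A^*$, $h\in H$: $\langle a\rightharpoonup a^*,b\rangle=\langle a^*,ba\rangle$, $\langle a^*\leftharpoonup a,b\rangle=\langle a^*,ab\rangle$, $\langle a^*\vartriangleleft h,b\rangle=\langle a^*,h\cdot b\rangle$, and $\langle a^*_{(1)},a\rangle\langle a^*_{(2)},b\rangle=\langle a^*,ab\rangle$. Structure of $A\#H$ (a weak Hopf algebra when $u$ acts trivially on $A$): $(a\#h)(b\#g)=a(h_{(1)}\cdot b)\#h_{(2)}g$, unit $1_A\#1_H$, $\tilde\Delta(a\#h)=a(R^2\cdot x^1)\#R^1h_{(1)}\otimes x^2\#h_{(2)}$, $\tilde\varepsilon(a\#h)=\langle\alpha_A,a\rangle\varepsilon(h)$, $\tilde S(a\#h)=(1_A\#S(h))(R^2\cdot a\#R^1)$. Structure of $B=A\otimes H\otimes A^*$ (a weak Hopf algebra): product $(a\otimes h\otimes a^* )(b\otimes g\otimes b^* )=\langle b^*,a\rangle b\otimes hg\otimes a^*$, unit $x^1\otimes1_H\otimes(x^2\rightharpoonup\alpha_A)$, $\Delta_B(a\otimes h\otimes a^* )=((R_1^2\cdot x^1)a\otimes R_2^1h_{(1)}R_1^1\otimes a^*_{(2)})\otimes(x^2\otimes h_{(2)}\otimes a^*_{(1)}\vartriangleleft R_2^2)$, $\varepsilon_B(a\otimes h\otimes a^* )=\langle\alpha_A,a\rangle\varepsilon(h)\langle a^*,1_A\rangle$,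 $S_B(a\otimes h\otimes a^* )=\langle a^*\vartriangleleft R_2^2,x^1\rangle x^2\otimes R_1^1S(R_2^1h)\otimes\alpha_A\leftharpoonup(R_1^2\cdot a)$. *)

(* Defs.v *)
From HB Require Import structures.
From mathcomp Require Import all_boot all_order all_algebra all_field.

Set Implicit Arguments.
Unset Strict Implicit.
Unset Printing Implicit Defensive.

Import GRing.Theory.
Local Open Scope ring_scope.

Reserved Notation "v ⊗ w" (at level 45, right associativity).
Reserved Notation "\tens_ ( v , w <- t ) E"
  (at level 46, v name, w name, t at level 60, E at level 46,
   format "'[' \tens_ ( v ,  w  <-  t ) '/  '  E ']'").
Reserved Notation "⟪ f , a ⟫" (format "⟪ f ,  a ⟫").

(* V ⊗ W is realised as the space of coordinate matrices with respect to the
   bases [vbasis {:V}] and [vbasis {:W}].  [tlift t f] is the value at t of the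
   linear map on V ⊗ W that agrees with f on pairs of basis vectors; it agrees
   with f on all pure tensors when f is bilinear (lemma [tliftE]), which is the
   case in every use below.

   [\tens_(v, w <- t) E] renders the usual summation-free notation: it stands
   for "E, where t = v ⊗ w (sum understood)". *)

Section Tensor.
Variable k : fieldType.
Implicit Types (V W : vectType k) (U : lmodType k).

Definition bas V (i : 'I_(\dim {:V})) : V := (vbasis {:V})`_i.
Definition crd V (i : 'I_(\dim {:V})) (v : V) : k := coord (vbasis {:V}) i v.

Definition tprod V W : vectType k := 'M[k]_(\dim {:V}, \dim {:W}).

Definition tpure V W (v : V) (w : W) : tprod V W :=
  \matrix_(i, j) (crd i v * crd j w).

Definition tlift V W U (t : tprod V W) (f : V -> W -> U) : U :=
  \sum_i \sum_j (t : 'M[k]__) i j *: f (bas i) (bas j).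

Definition bilin V W U (f : V -> W -> U) : Prop :=
  (forall v, linear (f v)) /\ (forall w, linear (f^~ w)).

End Tensor.

Arguments tprod {k} (V W)%_type.

Notation "v ⊗ w" := (tprod v w) : type_scope.
Notation "v ⊗ w" := (tpure v w) : ring_scope.
Notation "\tens_ ( v , w <- t ) E" := (tlift t (fun v w => E)) : ring_scope.

Section TensorTheory.
Variable k : fieldType.
Implicit Types (V W : vectType k) (U : lmodType k).

Lemma crd_bas V (v : V) : v = \sum_i crd i v *: bas i.
Proof. exact: (coord_vbasis (memvf v)). Qed.

Lemma crd_linear V i : linear (@crd k V i : V -> k^o).
Proof. by move=> a u v; rewrite /crd linearP. Qed.

Lemma crdE V (i j : 'I_(\dim {:V})) : crd i (bas j) = (i == j)%:R.
Proof.
by rewrite /crd /bas coord_free ?(basis_free (vbasisP _)) // eq_sym.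
Qed.

Lemma tpure_bilin V W : bilin (@tpure k V W).
Proof.
split=> [v a w1 w2|w a v1 v2]; apply/matrixP=> i j; rewrite !mxE crd_linear.
  by rewrite mulrDr mulrCA.
by rewrite mulrDl -mulrA.
Qed.

Lemma tlift_linear V W U (f : V -> W -> U) : linear (fun t : V ⊗ W => tlift t f).
Proof.
move=> a s t; rewrite /tlift scaler_sumr -big_split; apply: eq_bigr => i _ /=.
rewrite scaler_sumr -big_split; apply: eq_bigr => j _ /=.
by rewrite !mxE scalerDl scalerA.
Qed.

Lemma tliftE V W U (f : V -> W -> U) (v : V) (w : W) :
  bilin f -> tlift (v ⊗ w) f = f v w.
Proof.
case=> fr fl; rewrite {2}(crd_bas v).
pose Fl := GRing.isLinear.Build _ _ _ _ (f^~ w) (fl w).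
pose gl : {linear V -> U} := HB.pack (f^~ w) Fl.
rewrite -[LHS]/(tlift (v ⊗ w) f) -[f _ w]/(gl _) linear_sum /tlift.
apply: eq_bigr => i _; rewrite linearZ /= {2}(crd_bas w).
pose Fr := GRing.isLinear.Build _ _ _ _ (f (bas i)) (fr (bas i)).
pose gr : {linear W -> U} := HB.pack (f (bas i)) Fr.
rewrite -[f (bas i) (\sum_j _)]/(gr _) linear_sum scaler_sumr.
by apply: eq_bigr => j _; rewrite mxE linearZ /= scalerA.
Qed.

Lemma tlift_pure V W (t : V ⊗ W) : \tens_(v, w <- t) v ⊗ w = t.
Proof.
apply/matrixP=> i j; rewrite /tlift summxE (bigD1 i) //= summxE (bigD1 j) //=.
rewrite !mxE !crdE !eqxx !mulr1 !big1 ?addr0 // => [i' ni|j' nj].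
  by rewrite summxE big1 // => j' _; rewrite !mxE crdE eq_sym (negPf ni) mul0r mulr0.
by rewrite !mxE !crdE [j == j']eq_sym (negPf nj) !mulr0.
Qed.

End TensorTheory.

Section Dual.
Variable k : fieldType.

Definition dual (V : vectType k) : vectType k := 'Hom(V, k^o).

Definition ev (V : vectType k) (f : dual V) (v : V) : k^o := (f : 'Hom(V, k^o)) v.

Definition dual_bas (V : vectType k) (i : 'I_(\dim {:V})) : dual V :=
  linfun (@crd k V i : V -> k^o).

Lemma dual_basE (V : vectType k) i (v : V) : ev (dual_bas i) v = crd i v.
Proof.
pose Fc := GRing.isLinear.Build _ _ _ _ (@crd k V i : V -> k^o) (@crd_linear k V i).
pose c : {linear V -> k^o} := HB.pack (@crd k V i : V -> k^o) Fc.
exact: (lfunE c).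
Qed.

Definition precomp (V : vectType k) (f : dual V) (g : 'End(V)) : dual V :=
  (f \o g)%VF.

End Dual.

Notation "⟪ f , a ⟫" := (ev f a) : ring_scope.

Section DualAlgebra.
Variables (k : fieldType) (A : falgType k).

(* a ⇀ f  and  f ↼ a *)
Definition hitl (a : A) (f : dual A) : dual A := precomp f (amulr a).
Definition hitr (f : dual A) (a : A) : dual A := precomp f (amull a).

(* The transpose of the multiplication, read through A^* ⊗ A^* ≅ (A ⊗ A)^*. *)
Definition dual_comul (f : dual A) : dual A ⊗ dual A :=
  \sum_(i < \dim {:A}) \sum_(j < \dim {:A})
     ⟪f, bas i * bas j⟫ *: (dual_bas i ⊗ dual_bas j).

Lemma hitlE a f b : ⟪hitl a f, b⟫ = ⟪f, b * a⟫.
Proof. by rewrite /ev /hitl /precomp comp_lfunE lfunE. Qed.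

Lemma hitrE f a b : ⟪hitr f a, b⟫ = ⟪f, a * b⟫.
Proof. by rewrite /ev /hitr /precomp comp_lfunE lfunE. Qed.

Lemma dual_comulE f a b :
  \tens_(f1, f2 <- dual_comul f) (⟪f1, a⟫ * ⟪f2, b⟫ : k^o) = ⟪f, a * b⟫.
Proof.
set g := fun _ _ => _.
have gB : bilin g.
  split=> [f1 c p q|f2 c p q]; rewrite /g /ev add_lfunE scale_lfunE.
    by rewrite mulrDr; congr (_ + _); rewrite mulrCA.
  by rewrite mulrDl; congr (_ + _); rewrite -mulrA.
pose F := GRing.isLinear.Build _ _ _ _ (fun t => tlift t g) (tlift_linear g).
pose h : {linear (dual A ⊗ dual A)%type -> k^o} := HB.pack (fun t => tlift t g) F.
rewrite -[LHS]/(h _) {1}/dual_comul linear_sum.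
rewrite [in RHS](crd_bas a) [in RHS](crd_bas b) mulr_suml /ev linear_sum.
apply: eq_bigr => i _; rewrite linear_sum mulr_sumr linear_sum.
apply: eq_bigr => j _; rewrite linearZ /= tliftE //.
rewrite /g !dual_basE /ev -scalerAl -scalerAr !linearZ /=.
by congr (_ *: _); rewrite -[LHS]/(_ * _) mulrC.
Qed.

End DualAlgebra.

(* The algebra H is semisimple: its regular left module is completely
   reducible. *)
Definition left_ideal (k : fieldType) (H : falgType k) (I : {vspace H}) : Prop :=
  forall h v : H, v \in I -> h * v \in I.

Definition semisimple (k : fieldType) (H : falgType k) : Prop :=
  forall I : {vspace H}, left_ideal I ->
    exists J : {vspace H},
      [/\ left_ideal J, (I + J)%VS = fullv & (I :&: J)%VS = 0%VS].

Definition tmul (k : fieldType) (H : falgType k) (s t : H ⊗ H) : H ⊗ H :=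
  \tens_(a, b <- s) \tens_(c, d <- t) (a * c) ⊗ (b * d).

Record hopf (k : fieldType) (H : falgType k) := Hopf {
  Delta : {linear H -> (H ⊗ H)%type};
  eps : {linear H -> k^o};
  antipode : {linear H -> H};
  Delta1 : Delta 1 = 1 ⊗ 1;
  DeltaM : forall g h, Delta (g * h) = tmul (Delta g) (Delta h);
  eps1 : eps 1 = 1;
  epsM : forall g h, eps (g * h) = eps g * eps h;
  DeltaA : forall h,
    \tens_(h1, h2 <- Delta h) \tens_(h11, h12 <- Delta h1) h11 ⊗ h12 ⊗ h2
    = \tens_(h1, h2 <- Delta h) h1 ⊗ Delta h2;
  eps_l : forall h, \tens_(h1, h2 <- Delta h) (eps h1 : k) *: h2 = h;
  eps_r : forall h, \tens_(h1, h2 <- Delta h) (eps h2 : k) *: h1 = h;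
  S_l : forall h, \tens_(h1, h2 <- Delta h) antipode h1 * h2 = (eps h : k) *: 1;
  S_r : forall h, \tens_(h1, h2 <- Delta h) h1 * antipode h2 = (eps h : k) *: 1
}.

Definition quasitriangular (k : fieldType) (H : falgType k) (HH : hopf H)
    (R : H ⊗ H) : Prop :=
  [/\ exists R' : H ⊗ H, tmul R R' = 1 ⊗ 1 /\ tmul R' R = 1 ⊗ 1,
      forall h : H,
        \tens_(r1, r2 <- R) \tens_(h1, h2 <- Delta HH h) (r1 * h1) ⊗ (r2 * h2)
        = \tens_(r1, r2 <- R) \tens_(h1, h2 <- Delta HH h) (h2 * r1) ⊗ (h1 * r2),
      \tens_(r1, r2 <- R) \tens_(p, q <- Delta HH r1) p ⊗ q ⊗ r2
      = \tens_(r1, r2 <- R) \tens_(s1, s2 <- R) r1 ⊗ s1 ⊗ (r2 * s2)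
    & \tens_(r1, r2 <- R) \tens_(p, q <- Delta HH r2) r1 ⊗ p ⊗ q
      = \tens_(r1, r2 <- R) \tens_(s1, s2 <- R) (r1 * s1) ⊗ s2 ⊗ r2].

Definition drinfeld (k : fieldType) (H : falgType k) (HH : hopf H)
    (R : H ⊗ H) : H :=
  \tens_(r1, r2 <- R) antipode HH r2 * r1.

(* Left H-module algebras; [act h] is the operator a |-> h · a. *)
Record module_algebra (k : fieldType) (H : falgType k) (HH : hopf H)
    (A : falgType k) := ModuleAlgebra {
  act : {linear H -> 'End(A)};
  act1 : forall a, act 1 a = a;
  actM : forall g h a, act (g * h) a = act g (act h a);
  act_unit : forall h, act h 1 = (eps HH h : k) *: 1;
  act_mul : forall h a b,
    act h (a * b) = \tens_(h1, h2 <- Delta HH h) act h1 a * act h2 b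
}.

Definition quantum_commutative (k : fieldType) (H : falgType k) (HH : hopf H)
    (R : H ⊗ H) (A : falgType k) (M : module_algebra HH A) : Prop :=
  forall a b : A, a * b = \tens_(r1, r2 <- R) act M r2 b * act M r1 a.

(* A is strongly separable when it has such an x. *)
Definition symmetric_separability_idempotent (k : fieldType) (A : falgType k)
    (x : A ⊗ A) : Prop :=
  [/\ forall a : A, \tens_(x1, x2 <- x) (a * x1) ⊗ x2
                    = \tens_(x1, x2 <- x) x1 ⊗ (x2 * a),
      \tens_(x1, x2 <- x) x1 * x2 = 1
    & \tens_(x1, x2 <- x) x2 ⊗ x1 = x].

(* A homomorphism of weak Hopf algebras is a linear map compatible with the
   product, unit, coproduct, counit and antipode; only these structure maps
   enter the definition. *)

Record whopf_data (k : fieldType) := WHopfData {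
  wcar :> vectType k;
  wmul : wcar -> wcar -> wcar;
  wone : wcar;
  wcomul : wcar -> wcar ⊗ wcar;
  wcounit : wcar -> k;
  wanti : wcar -> wcar
}.

Record whopf_morphism (k : fieldType) (C D : whopf_data k) (f : C -> D) : Prop :=
  WHopfMorphism {
  whm_linear : linear f;
  whm_mul : forall s t : C, f (wmul s t) = wmul (f s) (f t);
  whm_one : f (wone C) = wone D;
  whm_comul : forall t : C,
    wcomul (f t) = \tens_(t1, t2 <- wcomul t) f t1 ⊗ f t2;
  whm_counit : forall t : C, wcounit (f t) = wcounit t;
  whm_anti : forall t : C, f (wanti t) = wanti (f t)
}.

Definition whopf_monomorphism (k : fieldType) (C D : whopf_data k)
    (f : C -> D) : Prop :=
  whopf_morphism f /\ injective f.

Arguments whopf_monomorphism {k} C D f.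

Section Construction.
Variables (k : fieldType) (H : falgType k) (HH : hopf H) (R : H ⊗ H).
Variables (A : falgType k) (M : module_algebra HH A).
Variables (x : A ⊗ A) (alpha : dual A).

Local Notation Delta := (Delta HH).
Local Notation eps := (eps HH).
Local Notation S := (antipode HH).
Local Notation "h ⋅ a" := (act M h a) (at level 35, right associativity).

(* f ◁ h *)
Definition dact (f : dual A) (h : H) : dual A := precomp f (act M h).

Lemma dactE f h b : ⟪dact f h, b⟫ = ⟪f, h ⋅ b⟫.
Proof. by rewrite /ev /dact /precomp comp_lfunE. Qed.

Definition smash_mul (s t : A ⊗ H) : A ⊗ H :=
  \tens_(a, h <- s) \tens_(b, g <- t) \tens_(h1, h2 <- Delta h)
    (a * (h1 ⋅ b)) ⊗ (h2 * g).

Definition smash_one : A ⊗ H := 1 ⊗ 1.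

Definition smash_comul (t : A ⊗ H) : (A ⊗ H) ⊗ (A ⊗ H) :=
  \tens_(a, h <- t) \tens_(r1, r2 <- R) \tens_(x1, x2 <- x)
  \tens_(h1, h2 <- Delta h)
    ((a * (r2 ⋅ x1)) ⊗ (r1 * h1)) ⊗ (x2 ⊗ h2).

Definition smash_counit (t : A ⊗ H) : k :=
  \tens_(a, h <- t) (⟪alpha, a⟫ * eps h : k^o).

Definition smash_anti (t : A ⊗ H) : A ⊗ H :=
  \tens_(a, h <- t) \tens_(r1, r2 <- R)
    smash_mul (1 ⊗ S h) ((r2 ⋅ a) ⊗ r1).

Definition smash : whopf_data k :=
  WHopfData smash_mul smash_one smash_comul smash_counit smash_anti.

(* Below, r1 ⊗ r2 and s1 ⊗ s2 are the copies R_1 and R_2 of R. *)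

Definition B_mul (t t' : A ⊗ H ⊗ dual A) : A ⊗ H ⊗ dual A :=
  \tens_(a, y <- t) \tens_(h, f <- y)
  \tens_(b, z <- t') \tens_(g, f' <- z)
    ⟪f', a⟫ *: (b ⊗ (h * g) ⊗ f).

Definition B_one : A ⊗ H ⊗ dual A :=
  \tens_(x1, x2 <- x) x1 ⊗ 1 ⊗ hitl x2 alpha.

Definition B_comul (t : A ⊗ H ⊗ dual A) :
    (A ⊗ H ⊗ dual A) ⊗ (A ⊗ H ⊗ dual A) :=
  \tens_(a, y <- t) \tens_(h, f <- y)
  \tens_(r1, r2 <- R) \tens_(s1, s2 <- R) \tens_(x1, x2 <- x)
  \tens_(h1, h2 <- Delta h) \tens_(f1, f2 <- dual_comul f)
    (((r2 ⋅ x1) * a) ⊗ (s1 * h1 * r1) ⊗ f2) ⊗ (x2 ⊗ h2 ⊗ dact f1 s2).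

Definition B_counit (t : A ⊗ H ⊗ dual A) : k :=
  \tens_(a, y <- t) \tens_(h, f <- y)
    (⟪alpha, a⟫ * eps h * ⟪f, 1⟫ : k^o).

Definition B_anti (t : A ⊗ H ⊗ dual A) : A ⊗ H ⊗ dual A :=
  \tens_(a, y <- t) \tens_(h, f <- y)
  \tens_(r1, r2 <- R) \tens_(s1, s2 <- R) \tens_(x1, x2 <- x)
    ⟪dact f s2, x1⟫ *: (x2 ⊗ (r1 * S (s1 * h)) ⊗ hitr alpha (r2 ⋅ a)).

Definition B : whopf_data k :=
  WHopfData B_mul B_one B_comul B_counit B_anti.

Definition phi (t : A ⊗ H) : A ⊗ H ⊗ dual A :=
  \tens_(a, h <- t) \tens_(x1, x2 <- x) \tens_(h1, h2 <- Delta h)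
    (S h1 ⋅ (x1 * a)) ⊗ h2 ⊗ hitl x2 alpha.

End Construction.

(* Main.v *)
From HB Require Import structures.
Require Import Defs.
From mathcomp Require Import all_boot all_order all_algebra all_field.
Import GRing.Theory.
Local Open Scope ring_scope.

Set Implicit Arguments.
Unset Strict Implicit.
Unset Printing Implicit Defensive.

(** The map a ⊗ f |-> (c |-> f(c) a) identifies A ⊗ A^* with End(A), and the
    product of B with that of End(A)^op ⊗ H.  Since x^1, x^2 are dual bases for
    the form α(ab), in these terms φ is simply

      φ(a # h) : c |-> S(h_1)·(c a) ⊗ h_2,

    and every claim about φ turns into an identity between tensors that depend
    on one or two parameters c, d in A ([evalB_inj], [evalBB_inj]).

    The hypothesis on u is used through its consequences for the action.
    - Since u h = S^2(h) u, the map S^2 acts trivially, so that S also acts as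
      its own inverse: S(h_2)·h_1·a = ε(h) a ([act_Sop]).
    - The form α(a) is the trace of b |-> a b.  As traces are cyclic, the
      previous point gives α(h·a) = ε(h) α(a); hence h and S(h) are adjoint for
      the form, and x is invariant ([alpha_act], [alpha_adj], [x_act]).
    - Being adjoint to u, also S(u) acts trivially.  Together with quantum
      commutativity this yields
      S(R^1_1)·(e (R^2·b)) ⊗ R^1_2 = (R^2·b) e ⊗ R^1 ([qc_twist]).

    Multiplicativity of φ then amounts to S(h_2)·(d (h_1·y)) = (S(h)·d) y
    ([act_Smul_absorb]).  For the coproduct, both sides at (c, d) are equal to
      (R^2·x^1)(S(h_1)·(c a)) ⊗ h_2 R^1 ⊗ (S(h_3)·d) x^2 ⊗ h_4 ;
    the relation between R and the coproduct is needed here in the form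
    S(h_1) R^2 ⊗ R^1 h_2 = R^2 S(h_2) ⊗ h_1 R^1 ([R_conj], [R_slide]).  For the
    antipode, both sides at c are equal to (R^2·a)(h_2·c) ⊗ S(h_1) R^1.
    Finally φ is injective, because at c = 1 it is a # h |-> S(h_1)·a ⊗ h_2,
    which has the left inverse b ⊗ g |-> g_1·b # g_2. *)

(** * Multilinear calculus for Sweedler notation *)

(** A constant of its own, so that the tactic below can recognise its goals
    syntactically, whichever path of structures led to the module types. *)
Definition lin (k : fieldType) (U V : lmodType k) (f : U -> V) : Prop := linear f.

Section Linear.
Variable k : fieldType.
Implicit Types (U V W X : vectType k) (L N : lmodType k).

Lemma lin_map L N (f : L -> N) (hf : lin f) : exists g : {linear L -> N}, g =1 f.
Proof.
pose F := GRing.isLinear.Build _ _ _ _ f hf.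
by exists (HB.pack f F : {linear L -> N}).
Qed.

Lemma linW L N (f : L -> N) : lin (fun v => f v) -> linear f.
Proof. by []. Qed.

Lemma linZ L N (f : L -> N) c v : lin f -> f (c *: v) = c *: f v.
Proof. by move=> /lin_map [g gE]; rewrite -!gE linearZ. Qed.

Lemma lin_eta L N (f : L -> N) : lin (fun v => f v) -> lin f.
Proof. by []. Qed.

Lemma lin_id L : lin (fun v : L => v).
Proof. by []. Qed.

Lemma lin_app L N N' (g : {linear N -> N'}) (e : L -> N) :
  lin e -> lin (fun v => g (e v)).
Proof. by move=> he c u v; rewrite he linearP. Qed.

Lemma lin_comp L N N' (g : N -> N') (e : L -> N) :
  lin g -> lin e -> lin (fun v => g (e v)).
Proof. by move=> hg he c u v; rewrite he hg. Qed.

Lemma lin_lfun L V W (g : 'Hom(V, W)) (e : L -> V) :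
  lin e -> lin (fun v => g (e v)).
Proof. by move=> he c u v; rewrite he linearP. Qed.

Lemma lin_lfunl L V W (g : L -> 'Hom(V, W)) (w : V) :
  lin g -> lin (fun v => g v w).
Proof. by move=> hg c u v; rewrite hg add_lfunE scale_lfunE. Qed.

Lemma lin_mull L (A : algType k) (a : A) (e : L -> A) :
  lin e -> lin (fun v => a * e v).
Proof. by move=> he c u v; rewrite he mulrDr scalerAr. Qed.

Lemma lin_mulr L (A : algType k) (a : A) (e : L -> A) :
  lin e -> lin (fun v => e v * a).
Proof. by move=> he c u v; rewrite he mulrDl scalerAl. Qed.

Lemma lin_scale L N (b : k) (e : L -> N) : lin e -> lin (fun v => b *: e v).
Proof. by move=> he c u v; rewrite he scalerDr !scalerA mulrC. Qed.

Lemma lin_scalel L N (n : N) (e : L -> k^o) :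
  lin e -> lin (fun v => (e v : k) *: n).
Proof. by move=> he c u v; rewrite he scalerDl scalerA. Qed.

Lemma lin_tpurel L V W (w : W) (e : L -> V) : lin e -> lin (fun v => e v ⊗ w).
Proof. by move=> he c u v; rewrite he (tpure_bilin V W).2. Qed.

Lemma lin_tpurer L V W (w : V) (e : L -> W) : lin e -> lin (fun v => w ⊗ e v).
Proof. by move=> he c u v; rewrite he (tpure_bilin V W).1. Qed.

Lemma lin_tlift L V W N (e : L -> V ⊗ W) (f : V -> W -> N) :
  lin e -> lin (fun v => tlift (e v) f).
Proof. by move=> he c u v; rewrite he tlift_linear. Qed.

Lemma lin_tlift_body L V W N (t : V ⊗ W) (F : L -> V -> W -> N) :
  (forall v w, lin (fun l => F l v w)) -> lin (fun l => tlift t (F l)).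
Proof.
move=> hF c u v; rewrite /tlift scaler_sumr -big_split; apply: eq_bigr => i _ /=.
rewrite scaler_sumr -big_split; apply: eq_bigr => j _ /=.
by rewrite hF scalerDr !scalerA mulrC.
Qed.

Lemma lin_hitl L (A : falgType k) (f : dual A) (e : L -> A) :
  lin e -> lin (fun v => hitl (e v) f).
Proof.
move=> he c u v; apply/lfunP => b.
rewrite -[LHS]/(ev _ b) -[RHS]/(ev _ b) hitlE he /ev !(add_lfunE, scale_lfunE).
by rewrite -!/(ev _ b) !hitlE mulrDr -scalerAr /ev linearP.
Qed.

Lemma lin_hitr L (A : falgType k) (f : dual A) (e : L -> A) :
  lin e -> lin (fun v => hitr f (e v)).
Proof.
move=> he c u v; apply/lfunP => b.
rewrite -[LHS]/(ev _ b) -[RHS]/(ev _ b) hitrE he /ev !(add_lfunE, scale_lfunE).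
by rewrite -!/(ev _ b) !hitrE mulrDl -scalerAl /ev linearP.
Qed.

Lemma lin_ev L V (f : dual V) (e : L -> V) : lin e -> lin (fun v => ⟪f, e v⟫).
Proof. exact: lin_lfun. Qed.

Lemma lin_evl L V (a : V) (e : L -> dual V) : lin e -> lin (fun v => ⟪e v, a⟫).
Proof. exact: lin_lfunl. Qed.

Lemma lin_dact L (H : falgType k) (HH : hopf H) (A : falgType k)
  (M : module_algebra HH A) (h : H) (e : L -> dual A) :
  lin e -> lin (fun v => dact M (e v) h).
Proof.
move=> he c u v; apply/lfunP => b.
rewrite -[LHS]/(ev _ b) -[RHS]/(ev _ b) dactE he /ev !(add_lfunE, scale_lfunE).
by rewrite -!/(ev _ b) !dactE.
Qed.

Lemma lin_dual_comul L (A : falgType k) (e : L -> dual A) :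
  lin e -> lin (fun v => dual_comul (e v)).
Proof.
move=> he c u v; rewrite /dual_comul scaler_sumr -big_split.
apply: eq_bigr => i _; rewrite /= scaler_sumr -big_split; apply: eq_bigr => j _.
by rewrite he /ev add_lfunE scale_lfunE scalerDl scalerA.
Qed.

End Linear.

Definition lin3 (k : fieldType) (V W X L : lmodType k) (f : V -> W -> X -> L) : Prop :=
  [/\ forall b c, lin (fun a => f a b c), forall a c, lin (fun b => f a b c)
    & forall a b, lin (fun c => f a b c)].

Section Lin3.
Variables (k : fieldType) (V W X L : lmodType k) (f : V -> W -> X -> L).
Hypothesis hf : lin3 f.
Lemma lin3_1 b c : lin (fun a => f a b c). Proof. by case: hf. Qed.
Lemma lin3_2 a c : lin (fun b => f a b c). Proof. by case: hf. Qed.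
Lemma lin3_3 a b : lin (fun c => f a b c). Proof. by case: hf. Qed.
End Lin3.

(** Proves goals [lin f], [bilin f] and [lin3 f] by recursion on the body of f.
    Every step of a Sweedler computation below leaves such a side condition.
    Variable multilinear maps are recognised by their hypotheses. *)
Ltac lin :=
  cbv beta;
  lazymatch goal with
  | |- forall _, _ => intros; lin
  | |- _ /\ _ => split; lin
  | |- lin3 _ => split; lin
  | |- bilin _ => split; lin
  | |- @lin ?k ?U ?V (fun x => @?e x) =>
    first
    [ exact (@lin_id k U)
    | match e with
      | fun x => @?a x * ?b => apply: (@lin_mulr _ _ _ b a); lin
      | fun x => ?b * @?a x => apply: (@lin_mull _ _ _ b a); lin
      | fun x => tpure (@?a x) ?b => apply: (@lin_tpurel _ _ _ _ b a); lin
      | fun x => tpure ?b (@?a x) => apply: (@lin_tpurer _ _ _ _ b a); lin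
      | fun x => ?b *: @?a x => apply: (@lin_scale _ _ _ b a); lin
      | fun x => @?a x *: ?b => apply: (@lin_scalel _ _ _ b a); lin
      | fun x => tlift (@?a x) ?f => apply: (@lin_tlift _ _ _ _ _ a f); lin
      | fun x => tlift ?t (@?F x) => apply: (@lin_tlift_body _ _ _ _ _ t F); lin
      | fun x => ev ?f (@?a x) => apply: (@lin_ev _ _ _ f a); lin
      | fun x => ev (@?a x) ?b => apply: (@lin_evl _ _ _ b a); lin
      | fun x => hitl (@?a x) ?b => apply: (@lin_hitl _ _ _ b a); lin
      | fun x => hitr ?b (@?a x) => apply: (@lin_hitr _ _ _ b a); lin
      | fun x => dact _ (@?a x) ?b => apply: (@lin_dact _ _ _ _ _ _ b a); lin
      | fun x => dual_comul (@?a x) => apply: (@lin_dual_comul _ _ _ a); lin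
      | fun x => fun_of_lfun ?f (@?a x) => apply: (@lin_lfun _ _ _ _ f a); lin
      | fun x => fun_of_lfun (@?f x) ?a => apply: (@lin_lfunl _ _ _ _ f a); lin
      | fun x => @GRing.Linear.sort _ _ _ _ ?f (@?a x) => apply: (@lin_app _ _ _ _ f a); lin
      | fun x => ?f (@?a x) =>
          match goal with hf : lin f |- _ => apply: (@lin_comp _ _ _ _ f a hf); lin end
      | fun x => ?f (@?a x) ?c =>
          match goal with hf : bilin f |- _ =>
            apply: (@lin_comp _ _ _ _ (fun y => f y c) a (proj2 hf c)); lin end
      | fun x => ?f ?c (@?a x) =>
          match goal with hf : bilin f |- _ =>
            apply: (@lin_comp _ _ _ _ (fun y => f c y) a (proj1 hf c)); lin end
      | fun x => ?f (@?a x) ?c ?d =>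
          match goal with hf : lin3 f |- _ =>
            apply: (@lin_comp _ _ _ _ (fun y => f y c d) a (lin3_1 hf c d)); lin end
      | fun x => ?f ?c (@?a x) ?d =>
          match goal with hf : lin3 f |- _ =>
            apply: (@lin_comp _ _ _ _ (fun y => f c y d) a (lin3_2 hf c d)); lin end
      | fun x => ?f ?c ?d (@?a x) =>
          match goal with hf : lin3 f |- _ =>
            apply: (@lin_comp _ _ _ _ (fun y => f c d y) a (lin3_3 hf c d)); lin end
      end ]
  | |- GRing.linear_for _ ?f => apply: linW; lin
  | |- lin _ => apply: lin_eta; lin
  end.

Section Calculus.
Variable k : fieldType.
Implicit Types (U V W X : vectType k) (L N : lmodType k).

Lemma eq_tlift V W L (t : V ⊗ W) (f g : V -> W -> L) :
  (forall v w, f v w = g v w) -> tlift t f = tlift t g.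
Proof.
by move=> fg; apply: eq_bigr => i _; apply: eq_bigr => j _; rewrite fg.
Qed.

Lemma lin_tlift_comm V W L N (g : L -> N) (t : V ⊗ W) (f : V -> W -> L) :
  lin g -> g (tlift t f) = tlift t (fun v w => g (f v w)).
Proof.
move=> /lin_map [h hg]; rewrite -hg linear_sum; apply: eq_bigr => i _.
by rewrite linear_sum; apply: eq_bigr => j _; rewrite linearZ /= hg.
Qed.

Lemma tlift_tlift V W V' W' L (t : V ⊗ W) (F : V -> W -> V' ⊗ W')
    (G : V' -> W' -> L) :
  tlift (tlift t F) G = tlift t (fun v w => tlift (F v w) G).
Proof. by apply: (lin_tlift_comm (g := fun s => tlift s G)); lin. Qed.

Lemma scale_tlift V W L (c : k) (t : V ⊗ W) (f : V -> W -> L) :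
  c *: tlift t f = tlift t (fun v w => c *: f v w).
Proof. by apply: (lin_tlift_comm (g := fun v => c *: v)); lin. Qed.

Lemma sum_tlift (I : finType) V W L (t : V ⊗ W) (f : I -> V -> W -> L) :
  \sum_i tlift t (f i) = tlift t (fun v w => \sum_i f i v w).
Proof.
rewrite /tlift exchange_big; apply: eq_bigr => i _ /=.
rewrite exchange_big; apply: eq_bigr => j _ /=.
by rewrite scaler_sumr.
Qed.

Lemma tlift_exch V W V' W' L (s : V ⊗ W) (t : V' ⊗ W')
    (f : V -> W -> V' -> W' -> L) :
  \tens_(a, b <- s) \tens_(c, d <- t) f a b c d
  = \tens_(c, d <- t) \tens_(a, b <- s) f a b c d.
Proof.
rewrite {1 4}/tlift; under eq_bigr do under eq_bigr do rewrite scale_tlift.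
under eq_bigr do rewrite sum_tlift.
rewrite sum_tlift; apply: eq_tlift => c d.
by apply: eq_bigr => i _; apply: eq_bigr => j _.
Qed.

Lemma tliftZ V W L (c : k) (t : V ⊗ W) (f : V -> W -> L) :
  tlift (c *: t) f = c *: tlift t f.
Proof.
by have [g gE] := lin_map (tlift_linear f : lin _); rewrite -!gE linearZ.
Qed.

Lemma scale_tliftl V W L (v : L) (t : V ⊗ W) (f : V -> W -> k^o) :
  (tlift t f : k) *: v = tlift t (fun a b => (f a b : k) *: v).
Proof. by apply: (lin_tlift_comm (g := fun c : k^o => (c : k) *: v)); lin. Qed.

Lemma mul_tliftr V W (A : falgType k) (a : A) (t : V ⊗ W) (f : V -> W -> A) :
  a * tlift t f = tlift t (fun v w => a * f v w).
Proof. by apply: (lin_tlift_comm (g := fun b => a * b)); lin. Qed.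

Lemma mul_tliftl V W (A : falgType k) (a : A) (t : V ⊗ W) (f : V -> W -> A) :
  tlift t f * a = tlift t (fun v w => f v w * a).
Proof. by apply: (lin_tlift_comm (g := fun b => b * a)); lin. Qed.

Lemma tpure_tliftr V W U X (u : U) (t : V ⊗ W) (f : V -> W -> X) :
  u ⊗ tlift t f = tlift t (fun v w => u ⊗ f v w).
Proof. by apply: (lin_tlift_comm (g := fun b => u ⊗ b)); lin. Qed.

Lemma tpure_tliftl V W U X (u : U) (t : V ⊗ W) (f : V -> W -> X) :
  tlift t f ⊗ u = tlift t (fun v w => f v w ⊗ u).
Proof. by apply: (lin_tlift_comm (g := fun b => b ⊗ u)); lin. Qed.

Lemma lapp_tlift V W L N (g : {linear L -> N}) (t : V ⊗ W) (f : V -> W -> L) :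
  g (tlift t f) = tlift t (fun v w => g (f v w)).
Proof. by apply: (lin_tlift_comm (g := g)) => c u v; rewrite linearP. Qed.

Lemma lfun_tliftl V W U X (u : U) (t : V ⊗ W) (f : V -> W -> 'Hom(U, X)) :
  (tlift t f : 'Hom(U, X)) u = tlift t (fun v w => f v w u).
Proof. by apply: (lin_tlift_comm (g := fun g : 'Hom(U, X) => g u)); lin. Qed.

Lemma tliftE3 V W X L (f : V -> W -> X -> L) u v w : lin3 f ->
  \tens_(a, y <- u ⊗ v ⊗ w) \tens_(b, c <- y) f a b c = f u v w.
Proof.
by move=> hf; rewrite tliftE ?tliftE //; lin.
Qed.

End Calculus.

Ltac tcongr := repeat (apply: eq_tlift => ? ?).

Section Ext.
Variable k : fieldType.

(** Pure tensors span, so linear maps are determined on them; this is how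
    every identity below is reduced to generators. *)
Lemma tens_ext (V W : vectType k) (L : lmodType k) (f g : (V ⊗ W)%type -> L) t :
  lin f -> lin g -> (forall v w, f (v ⊗ w) = g (v ⊗ w)) -> f t = g t.
Proof.
move=> hf hg E; rewrite -[t]tlift_pure (lin_tlift_comm _ _ hf).
by rewrite (lin_tlift_comm _ _ hg); tcongr.
Qed.

Lemma tens_ext3 (V W X : vectType k) (L : lmodType k)
    (f g : (V ⊗ W ⊗ X)%type -> L) t :
  lin f -> lin g -> (forall u v w, f (u ⊗ v ⊗ w) = g (u ⊗ v ⊗ w)) -> f t = g t.
Proof.
move=> hf hg E; apply: tens_ext => // u y.
by apply: (tens_ext (f := fun y => f (u ⊗ y)) (g := fun y => g (u ⊗ y))) => //; lin.
Qed.

Lemma tpureZl (V W : vectType k) (c : k) (v : V) (w : W) :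
  (c *: v) ⊗ w = c *: (v ⊗ w).
Proof. by apply: (linZ (f := fun z => z ⊗ w)); lin. Qed.

Lemma tpureZr (V W : vectType k) (c : k) (v : V) (w : W) :
  v ⊗ (c *: w) = c *: (v ⊗ w).
Proof. by apply: (linZ (f := fun z => v ⊗ z)); lin. Qed.
End Ext.

(** * Hopf algebras *)

Section HopfTheory.
Variables (k : fieldType) (H : falgType k) (HH : hopf H).
Implicit Types (L : lmodType k).
Local Notation Δ := (Delta HH).
Local Notation ε := (eps HH).
Local Notation S := (antipode HH).

(** The axioms of a Hopf algebra are equations between tensors; here and in
    the next lemmas they are applied to arbitrary multilinear expressions in
    the legs, which is what a computation in Sweedler notation does. *)
Lemma coassoc L (f : H -> H -> H -> L) h : lin3 f ->
  \tens_(t, c <- Δ h) \tens_(a, b <- Δ t) f a b c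
  = \tens_(a, t <- Δ h) \tens_(b, c <- Δ t) f a b c.
Proof.
move=> hf.
have := congr1 (fun t => tlift t (fun a y => tlift y (f a))) (DeltaA HH h).
rewrite !tlift_tlift => E; transitivity (tlift (Δ h) (fun t c =>
  tlift (\tens_(a, b <- Δ t) a ⊗ b ⊗ c) (fun a y => tlift y (f a)))).
  by apply: eq_tlift => t c; rewrite tlift_tlift; tcongr; rewrite tliftE3.
by rewrite E; tcongr; rewrite tliftE //; lin.
Qed.

Lemma counitl L (f : H -> L) h : lin f ->
  \tens_(a, b <- Δ h) (ε a : k) *: f b = f h.
Proof.
move=> hf; rewrite -[in RHS](eps_l HH h) (lin_tlift_comm _ _ hf).
by tcongr; rewrite (linZ _ _ hf).
Qed.

Lemma counitr L (f : H -> L) h : lin f ->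
  \tens_(a, b <- Δ h) (ε b : k) *: f a = f h.
Proof.
move=> hf; rewrite -[in RHS](eps_r HH h) (lin_tlift_comm _ _ hf).
by tcongr; rewrite (linZ _ _ hf).
Qed.

Lemma antipodel L (f : H -> L) h : lin f ->
  \tens_(a, b <- Δ h) f (S a * b) = (ε h : k) *: f 1.
Proof.
move=> hf; rewrite -(lin_tlift_comm _ _ hf) S_l.
by rewrite (linZ _ _ hf).
Qed.

Lemma antipoder L (f : H -> L) h : lin f ->
  \tens_(a, b <- Δ h) f (a * S b) = (ε h : k) *: f 1.
Proof.
move=> hf; rewrite -(lin_tlift_comm _ _ hf) S_r.
by rewrite (linZ _ _ hf).
Qed.

Lemma DeltaM_lift L (f : H -> H -> L) g h : bilin f ->
  \tens_(p, q <- Δ (g * h)) f p q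
  = \tens_(g1, g2 <- Δ g) \tens_(h1, h2 <- Δ h) f (g1 * h1) (g2 * h2).
Proof.
by move=> hf; rewrite DeltaM /tmul tlift_tlift; apply: eq_tlift => a b;
   rewrite tlift_tlift; apply: eq_tlift => c d; rewrite tliftE.
Qed.

Lemma Delta1_lift L (f : H -> H -> L) : bilin f ->
  \tens_(p, q <- Δ 1) f p q = f 1 1.
Proof. by move=> hf; rewrite Delta1 tliftE. Qed.

(** The antipode axiom in the form in which computations meet it: the two
    legs a, b occur only through S(a) b. *)
Lemma contractl L (f : H -> L) (G : H -> H -> L) y h :
  (forall a b, G a b = f (S a * b)) -> lin f -> f 1 = y ->
  \tens_(a, b <- Δ h) G a b = (ε h : k) *: y.
Proof. by move=> E hf <-; rewrite -antipodel //; tcongr. Qed.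

Lemma contractr L (f : H -> L) (G : H -> H -> L) y h :
  (forall a b, G a b = f (a * S b)) -> lin f -> f 1 = y ->
  \tens_(a, b <- Δ h) G a b = (ε h : k) *: y.
Proof. by move=> E hf <-; rewrite -antipoder //; tcongr. Qed.

(** If legs 1 and 2 of h_1 ⊗ h_2 ⊗ h_3 contract to a counit, only h_3 = h is
    left; by coassociativity the contraction may be made first. *)
Lemma cancel_l L (f : H -> H -> H -> L) (g : H -> L) h : lin3 f -> lin g ->
  (forall t c, \tens_(a, b <- Δ t) f a b c = (ε t : k) *: g c) ->
  \tens_(a, t <- Δ h) \tens_(b, c <- Δ t) f a b c = g h.
Proof.
move=> hf hg E; rewrite -coassoc // -[RHS]counitl //.
by apply: eq_tlift => t c; rewrite E.
Qed.

Lemma cancel_r L (f : H -> H -> H -> L) (g : H -> L) h : lin g ->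
  (forall a t, \tens_(b, c <- Δ t) f a b c = (ε t : k) *: g a) ->
  \tens_(a, t <- Δ h) \tens_(b, c <- Δ t) f a b c = g h.
Proof.
move=> hg E; rewrite -[RHS]counitr //.
by apply: eq_tlift => a t; rewrite E.
Qed.

Lemma antipode1 : S 1 = 1.
Proof.
have := S_l HH 1; rewrite Delta1 tliftE; last by lin.
by rewrite mulr1 eps1 scale1r.
Qed.

Lemma eps_antipode h : ε (S h) = ε h.
Proof.
transitivity (\tens_(a, b <- Δ h) (ε (S a * b) : k^o)); last first.
  by rewrite (antipodel (f := ε)) ?eps1 /=; [rewrite -[RHS]mulr1|lin].
rewrite -[in LHS](counitr (f := fun x => ε (S x))); last by lin.
by tcongr; rewrite epsM mulrC.
Qed.

(** Both S(gh) and S(h) S(g) are convolution inverse to the product: the sum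
    S(g_1 h_1) (g_2 h_2) S(h_3) S(g_3) contracts to either one. *)
Lemma antipodeM g h : S (g * h) = S h * S g.
Proof.
transitivity (\tens_(g1, gt <- Δ g) \tens_(g2, g3 <- Δ gt)
  \tens_(h1, ht <- Δ h) \tens_(h2, h3 <- Δ ht)
     S (g1 * h1) * (g2 * h2) * (S h3 * S g3)).
  symmetry; apply: (cancel_r (g := fun g1 => S (g1 * h))); first by lin.
  move=> g1 gt.
  transitivity (\tens_(g2, g3 <- Δ gt) S (g1 * h) * (g2 * S g3)).
    apply: eq_tlift => g2 g3.
    apply: (cancel_r (g := fun h1 => S (g1 * h1) * (g2 * S g3))); first by lin.
    move=> h1 ht; apply: (contractr (f := fun x => S (g1 * h1) * (g2 * x * S g3))).
    - by move=> h2 h3; rewrite !mulrA.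
    - by lin.
    - by rewrite mulr1.
  by apply: (contractr (f := fun x => S (g1 * h) * x)) => //; [lin|rewrite mulr1].
rewrite -coassoc; last by lin.
transitivity (\tens_(gt, g3 <- Δ g) (ε gt : k) *: (S h * S g3)); last first.
  by rewrite counitl //; lin.
apply: eq_tlift => gt g3; rewrite tlift_exch.
under eq_tlift => h1 ht do rewrite tlift_exch.
apply: (cancel_l (g := fun h3 => (ε gt : k) *: (S h3 * S g3))); [lin|lin|].
move=> t c; rewrite tlift_exch.
transitivity (\tens_(p, q <- Δ (gt * t)) (S p * q) * (S c * S g3)).
  by rewrite DeltaM_lift //; lin.
rewrite scalerA [_ * ε gt]mulrC -epsM.
by apply: (contractl (f := fun x => x * (S c * S g3))) => //; [lin|rewrite mul1r].
Qed.

(** As for products, Δ(S(h_1)) (h_2 ⊗ h_3) (S(h_5) ⊗ S(h_4)) contracts to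
    Δ(S(h)) from the right and to S(h_2) ⊗ S(h_1) from the left. *)
Lemma antipode_comul L (f : H -> H -> L) h : bilin f ->
  \tens_(p, q <- Δ (S h)) f p q = \tens_(a, b <- Δ h) f (S b) (S a).
Proof.
move=> hf.
pose G h1 h2 h3 h4 h5 :=
  \tens_(p, q <- Δ (S h1)) f (p * (h2 * S h5)) (q * (h3 * S h4)).
transitivity (\tens_(h1, t <- Δ h) \tens_(h2, t2 <- Δ t)
  \tens_(h3, t3 <- Δ t2) \tens_(h4, h5 <- Δ t3) G h1 h2 h3 h4 h5); rewrite /G.
  symmetry.
  transitivity (\tens_(h1, t <- Δ h) \tens_(h2, t2 <- Δ t)
    \tens_(p, q <- Δ (S h1)) f (p * (h2 * S t2)) q).
    apply: eq_tlift => h1 t; apply: eq_tlift => h2 t2.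
    apply: (cancel_l (g := fun t2 => \tens_(p, q <- Δ (S h1)) f (p * (h2 * S t2)) q)).
    - by lin.
    - by lin.
    move=> t3 c; apply: (contractr (f := fun x =>
      \tens_(p, q <- Δ (S h1)) f (p * (h2 * S c)) (q * x))) => //; first by lin.
    by tcongr; rewrite mulr1.
  apply: (cancel_r (g := fun h1 => \tens_(p, q <- Δ (S h1)) f p q)); first by lin.
  move=> a t; apply: (contractr (f := fun x =>
    \tens_(p, q <- Δ (S a)) f (p * x) q)) => //; first by lin.
  by tcongr; rewrite mulr1.
transitivity (\tens_(h1, t <- Δ h) \tens_(m, t3 <- Δ t) \tens_(h2, h3 <- Δ m)
  \tens_(h4, h5 <- Δ t3) G h1 h2 h3 h4 h5); rewrite /G.
  by apply: eq_tlift => h1 t; rewrite coassoc //; lin.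
apply: (cancel_l (g := fun t => \tens_(a, b <- Δ t) f (S b) (S a))); [lin|lin|].
move=> t c; transitivity (\tens_(h1, m <- Δ t) \tens_(p, q <- Δ (S h1 * m))
  \tens_(h4, h5 <- Δ c) f (p * S h5) (q * S h4)).
  apply: eq_tlift => h1 m; rewrite DeltaM_lift; last by lin.
  rewrite [RHS]tlift_exch; apply: eq_tlift => h2 h3; rewrite tlift_exch.
  by tcongr; rewrite !mulrA.
apply: (contractl (f := fun x => \tens_(p, q <- Δ x)
  \tens_(h4, h5 <- Δ c) f (p * S h5) (q * S h4))) => //; first by lin.
by rewrite Delta1_lift; [tcongr; rewrite !mul1r|lin].
Qed.

(** * Quasi-triangular structures *)

Section QuasiTriangular.
Variable R : H ⊗ H.
Hypothesis hR : quasitriangular HH R.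

Lemma R_comul L (f : H -> H -> L) h : bilin f ->
  \tens_(r1, r2 <- R) \tens_(h1, h2 <- Δ h) f (r1 * h1) (r2 * h2)
  = \tens_(r1, r2 <- R) \tens_(h1, h2 <- Δ h) f (h2 * r1) (h1 * r2).
Proof.
move=> hf; have [_ E _ _] := hR; have := congr1 (fun t => tlift t f) (E h).
rewrite !tlift_tlift => E'; etransitivity; last etransitivity; last 2 first.
- exact: E'.
- by apply: eq_tlift => r1 r2; rewrite tlift_tlift; tcongr; rewrite tliftE.
by apply: eq_tlift => r1 r2; rewrite tlift_tlift; tcongr; rewrite tliftE.
Qed.

Lemma R_Deltal L (f : H -> H -> H -> L) : lin3 f ->
  \tens_(r1, r2 <- R) \tens_(p, q <- Δ r1) f p q r2
  = \tens_(r1, r2 <- R) \tens_(s1, s2 <- R) f r1 s1 (r2 * s2).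
Proof.
move=> hf; have [_ _ E _] := hR.
have := congr1 (fun t => tlift t (fun a y => tlift y (f a))) E.
rewrite !tlift_tlift => E'; etransitivity; last etransitivity; last 2 first.
- exact: E'.
- by apply: eq_tlift => r1 r2; rewrite tlift_tlift; tcongr; rewrite tliftE3.
by apply: eq_tlift => r1 r2; rewrite tlift_tlift; tcongr; rewrite tliftE3.
Qed.

Lemma R_Deltar L (f : H -> H -> H -> L) : lin3 f ->
  \tens_(r1, r2 <- R) \tens_(p, q <- Δ r2) f r1 p q
  = \tens_(r1, r2 <- R) \tens_(s1, s2 <- R) f (r1 * s1) s2 r2.
Proof.
move=> hf; have [_ _ _ E] := hR.
have := congr1 (fun t => tlift t (fun a y => tlift y (f a))) E.
rewrite !tlift_tlift => E'; etransitivity; last etransitivity; last 2 first.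
- exact: E'.
- by apply: eq_tlift => r1 r2; rewrite tlift_tlift; tcongr; rewrite tliftE3.
by apply: eq_tlift => r1 r2; rewrite tlift_tlift; tcongr; rewrite tliftE3.
Qed.

(** Applying the counit to the first leg of (Δ ⊗ id)(R) gives R = (1 ⊗ e) R
    with e = ε(R^1) R^2, and R is invertible. *)
Lemma R_epsl L (f : H -> L) : lin f ->
  \tens_(r1, r2 <- R) (ε r1 : k) *: f r2 = f 1.
Proof.
move=> hf; have [[R' [RR' _]] _ _ _] := hR.
have inv (g : H -> L) : lin g ->
    \tens_(r1, r2 <- R) \tens_(p1, p2 <- R') (ε (r1 * p1) : k) *: g (r2 * p2) = g 1.
  move=> hg; have := congr1 (fun t => \tens_(a, b <- t) (ε a : k) *: g b) RR'.
  rewrite /tmul tlift_tlift tliftE; last by lin.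
  rewrite eps1 scale1r => <-; apply: eq_tlift => r1 r2.
  by rewrite tlift_tlift; tcongr; rewrite tliftE //; lin.
rewrite -inv //.
transitivity (\tens_(r1, r2 <- R) \tens_(s1, s2 <- R) (ε r1 : k) *:
  \tens_(p1, p2 <- R') (ε (s1 * p1) : k) *: f (r2 * s2 * p2)).
  apply: eq_tlift => r1 r2; rewrite -scale_tlift; congr (_ *: _).
  rewrite -[RHS](_ : \tens_(s1, s2 <- R) \tens_(p1, p2 <- R')
    (ε (s1 * p1) : k) *: f (r2 * (s2 * p2)) = _).
    by rewrite (inv (fun x => f (r2 * x))) ?mulr1 //; lin.
  by tcongr; rewrite mulrA.
rewrite -(R_Deltal (f := fun a b c => (ε a : k) *:
  \tens_(p1, p2 <- R') (ε (b * p1) : k) *: f (c * p2))); last by lin.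
by apply: eq_tlift => r1 r2; rewrite counitl //; lin.
Qed.

(** The inverse of R is (S ⊗ id)(R): contract the first two legs of
    (Δ ⊗ id)(R). *)
Lemma R_invl L (f : H -> H -> L) : bilin f ->
  \tens_(r1, r2 <- R) \tens_(s1, s2 <- R) f (S r1 * s1) (r2 * s2) = f 1 1.
Proof.
move=> hf; rewrite -(R_Deltal (f := fun a b c => f (S a * b) c)); last by lin.
rewrite -[RHS]R_epsl; last by lin.
by apply: eq_tlift => r1 r2; apply: (contractl (f := fun x => f x r2)) => //; lin.
Qed.

Lemma R_invr L (f : H -> H -> L) : bilin f ->
  \tens_(r1, r2 <- R) \tens_(s1, s2 <- R) f (r1 * S s1) (r2 * s2) = f 1 1.
Proof.
move=> hf; rewrite -(R_Deltal (f := fun a b c => f (a * S b) c)); last by lin.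
rewrite -[RHS]R_epsl; last by lin.
by apply: eq_tlift => r1 r2; apply: (contractr (f := fun x => f x r2)) => //; lin.
Qed.

(** As for the other leg, (id ⊗ Δ)(R) gives R = (e ⊗ 1) R with
    e = R^1 ε(R^2). *)
Lemma R_epsr L (f : H -> L) : lin f ->
  \tens_(r1, r2 <- R) (ε r2 : k) *: f r1 = f 1.
Proof.
move=> hf; pose g x y := (ε y : k) *: f x.
have hg : bilin g by rewrite /g; lin.
have <- : g 1 1 = f 1 by rewrite /g eps1 scale1r.
rewrite -R_invr; last by lin.
transitivity (\tens_(r1, r2 <- R) \tens_(s1, s2 <- R) (ε r2 : k) *:
  \tens_(p1, p2 <- R) g (r1 * s1 * S p1) (s2 * p2)).
  apply: eq_tlift => r1 r2; rewrite -scale_tlift; congr (_ *: _).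
  rewrite -[RHS](_ : \tens_(s1, s2 <- R) \tens_(p1, p2 <- R)
    g (r1 * (s1 * S p1)) (s2 * p2) = _).
    rewrite (R_invr (f := fun x y => g (r1 * x) y)); last by lin.
    by rewrite /g eps1 scale1r mulr1.
  by tcongr; rewrite mulrA.
rewrite -(R_Deltar (f := fun a b c => (ε c : k) *:
  \tens_(p1, p2 <- R) g (a * S p1) (b * p2))); last by lin.
by apply: eq_tlift => r1 r2; rewrite counitr //; lin.
Qed.

(** Contracting the last two legs of (id ⊗ Δ) of R^-1 = S(R^1) ⊗ R^2 shows that
    (S ⊗ S)(R) is a left inverse of R^-1, hence equal to R. *)
Lemma R_SS L (f : H -> H -> L) : bilin f ->
  \tens_(r1, r2 <- R) f (S r1) (S r2) = \tens_(r1, r2 <- R) f r1 r2.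
Proof.
move=> hf.
have inv (g : H -> H -> L) : bilin g ->
    \tens_(r1, r2 <- R) \tens_(s1, s2 <- R) g (S r1 * S s1) (S r2 * s2) = g 1 1.
  move=> hg; rewrite tlift_exch.
  transitivity (\tens_(r1, r2 <- R) \tens_(p, q <- Δ r2) g (S r1) (S p * q)).
    rewrite R_Deltar; last by lin.
    by tcongr; rewrite antipodeM.
  transitivity (g (S 1) 1); last by rewrite antipode1.
  rewrite -(R_epsr (f := fun x => g (S x) 1)); last by lin.
  by apply: eq_tlift => r1 r2; apply: (contractl (f := g (S r1))) => //; lin.
transitivity (\tens_(r1, r2 <- R) \tens_(s1, s2 <- R)
  \tens_(p1, p2 <- R) f (S r1 * S s1 * p1) (S r2 * s2 * p2)).
  apply: eq_tlift => r1 r2; symmetry.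
  rewrite -[S r1 in RHS]mulr1 -[S r2 in RHS]mulr1.
  rewrite -(R_invl (f := fun x y => f (S r1 * x) (S r2 * y))); last by lin.
  by tcongr; rewrite !mulrA.
rewrite (inv (fun x y => \tens_(p1, p2 <- R) f (x * p1) (y * p2))); last by lin.
by tcongr; rewrite !mul1r.
Qed.

(** Evaluate S^2(h_3) S(R^2 h_2) R^1 h_1 with either side of the relation
    between R and the coproduct. *)
Lemma drinfeldM h : drinfeld HH R * h = S (S h) * drinfeld HH R.
Proof.
pose f x y z := S (S z) * (S y * x).
transitivity (\tens_(h1, t <- Δ h) (ε t : k) *: (drinfeld HH R * h1)).
  by rewrite counitr //; lin.
transitivity (\tens_(t, h3 <- Δ h) \tens_(r1, r2 <- R) \tens_(h1, h2 <- Δ t)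
    f (r1 * h1) (r2 * h2) h3).
  under [RHS]eq_tlift do rewrite tlift_exch.
  rewrite coassoc; last by rewrite /f; lin.
  apply: eq_tlift => h1 t; symmetry.
  apply: (contractr (f := fun x => S x * (drinfeld HH R * h1))).
  - move=> a b; rewrite /drinfeld mul_tliftl mul_tliftr /f.
    by tcongr; rewrite !antipodeM !mulrA.
  - by lin.
  - by rewrite antipode1 mul1r.
transitivity (\tens_(t, h3 <- Δ h) \tens_(r1, r2 <- R) \tens_(h1, h2 <- Δ t)
    f (h2 * r1) (h1 * r2) h3).
  by apply: eq_tlift => t h3; rewrite (R_comul (f := fun x y => f x y h3)) // /f; lin.
under eq_tlift do rewrite tlift_exch.
rewrite coassoc; last by rewrite /f; lin.
apply: (cancel_l (g := fun x => S (S x) * drinfeld HH R)); [rewrite /f; lin|lin|].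
move=> t c; apply: (contractl (f := fun x => S (S c) *
  \tens_(r1, r2 <- R) S r2 * (x * r1))); [|lin|].
- by move=> a b; rewrite mul_tliftr /f; tcongr; rewrite !antipodeM !mulrA.
- by rewrite /drinfeld; congr (_ * _); tcongr; rewrite mul1r.
Qed.

(** Both sides are contractions of S(h_1) R^2 h_3 S(h_4) ⊗ R^1 h_2, once before
    and once after moving R across h_2 ⊗ h_3. *)
Lemma R_conj L (f : H -> H -> L) h : bilin f ->
  \tens_(r1, r2 <- R) \tens_(h1, h2 <- Δ h) f (S h1 * r2) (r1 * h2)
  = \tens_(r1, r2 <- R) \tens_(h1, h2 <- Δ h) f (r2 * S h2) (h1 * r1).
Proof.
move=> hf.
transitivity (\tens_(h1, t <- Δ h) \tens_(m, h4 <- Δ t) \tens_(r1, r2 <- R)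
   \tens_(h2, h3 <- Δ m) f (S h1 * (r2 * h3) * S h4) (r1 * h2)).
  under [RHS]eq_tlift do under eq_tlift do rewrite tlift_exch.
  rewrite tlift_exch; apply: eq_tlift => h1 t.
  rewrite coassoc; last by lin.
  symmetry; apply: (cancel_r (g := fun t => \tens_(r1, r2 <- R) f (S h1 * r2) (r1 * t))).
    by lin.
  move=> a t'; apply: (contractr (f := fun x =>
    \tens_(r1, r2 <- R) f (S h1 * r2 * x) (r1 * a))); [|lin|].
  - by move=> *; tcongr; rewrite !mulrA.
  - by tcongr; rewrite mulr1.
transitivity (\tens_(h1, t <- Δ h) \tens_(m, h4 <- Δ t) \tens_(r1, r2 <- R)
   \tens_(h2, h3 <- Δ m) f (S h1 * (h2 * r2) * S h4) (h3 * r1)).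
  apply: eq_tlift => h1 t; apply: eq_tlift => m h4.
  by rewrite (R_comul (f := fun x y => f (S h1 * y * S h4) x)) //; lin.
under eq_tlift do under eq_tlift do rewrite tlift_exch.
rewrite [RHS]tlift_exch.
transitivity (\tens_(h1, t <- Δ h) \tens_(h2, t' <- Δ t) \tens_(h3, h4 <- Δ t')
  \tens_(r1, r2 <- R) f (S h1 * (h2 * r2) * S h4) (h3 * r1)).
  by apply: eq_tlift => h1 t; rewrite coassoc //; lin.
apply: (cancel_l (g := fun t' => \tens_(h3, h4 <- Δ t')
  \tens_(r1, r2 <- R) f (r2 * S h4) (h3 * r1))); [lin|lin|].
move=> t c; apply: (contractl (f := fun x => \tens_(h3, h4 <- Δ c)
  \tens_(r1, r2 <- R) f (x * r2 * S h4) (h3 * r1))); [|lin|].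
- by move=> *; tcongr; rewrite !mulrA.
- by tcongr; rewrite mul1r.
Qed.

End QuasiTriangular.
End HopfTheory.

Arguments coassoc {k H HH L f} h _.
Arguments counitl {k H HH L f} h _.
Arguments counitr {k H HH L f} h _.
Arguments DeltaM_lift {k H HH L f} g h _.
Arguments antipode_comul {k H HH L f} h _.

(** * The trace form of a strongly separable algebra *)

Section Frobenius.
Variables (k : fieldType) (A : falgType k) (x : A ⊗ A) (alpha : dual A).
Hypothesis hx : symmetric_separability_idempotent x.
Hypothesis halpha : \tens_(x1, x2 <- x) ⟪alpha, x1⟫ *: x2 = 1.
Implicit Types (L : lmodType k).
Local Notation α a := ⟪alpha, a⟫.

Lemma x_sep L (f : A -> A -> L) a : bilin f ->
  \tens_(x1, x2 <- x) f (a * x1) x2 = \tens_(x1, x2 <- x) f x1 (x2 * a).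
Proof.
move=> hf; have [E _ _] := hx; have := congr1 (fun t => tlift t f) (E a).
rewrite !tlift_tlift => E'; etransitivity; last etransitivity; last 2 first.
- exact: E'.
- by tcongr; rewrite tliftE.
by tcongr; rewrite tliftE.
Qed.

Lemma x_sym L (f : A -> A -> L) : bilin f ->
  \tens_(x1, x2 <- x) f x2 x1 = \tens_(x1, x2 <- x) f x1 x2.
Proof.
move=> hf; have [_ _ E] := hx; rewrite -{2}E tlift_tlift.
by tcongr; rewrite tliftE.
Qed.

Lemma x_sep' L (f : A -> A -> L) a : bilin f ->
  \tens_(x1, x2 <- x) f (x1 * a) x2 = \tens_(x1, x2 <- x) f x1 (a * x2).
Proof.
move=> hf; rewrite -(x_sym (f := fun b c => f (b * a) c)); last by lin.
rewrite -(x_sym (f := fun b c => f b (a * c))); last by lin.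
by rewrite (x_sep (f := fun b c => f c b)) //; lin.
Qed.

Lemma x_mul L (f : A -> L) : lin f -> \tens_(x1, x2 <- x) f (x1 * x2) = f 1.
Proof. by move=> hf; have [_ <- _] := hx; rewrite (lin_tlift_comm _ _ hf). Qed.

(** By separability c passes to the other leg, and the normalisation of α is
    left.  With the next two lemmas, which differ from this one in the order of
    factors and legs, x^1 and x^2 are dual bases for the form α(ab). *)
Lemma alphaxl L (f : A -> L) c : lin f ->
  \tens_(x1, x2 <- x) (α (c * x1) : k) *: f x2 = f c.
Proof.
move=> hf; rewrite (x_sep (f := fun a b => (α a : k) *: f b)); last by lin.
rewrite -[in RHS](mul1r c) -halpha mul_tliftl (lin_tlift_comm _ _ hf).
by tcongr; rewrite -scalerAl (linZ _ _ hf).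
Qed.

Lemma alphaxr L (f : A -> L) c : lin f ->
  \tens_(x1, x2 <- x) (α (x1 * c) : k) *: f x2 = f c.
Proof.
move=> hf; rewrite (x_sep' (f := fun a b => (α a : k) *: f b)); last by lin.
rewrite -[in RHS](mulr1 c) -halpha mul_tliftr (lin_tlift_comm _ _ hf).
by tcongr; rewrite -scalerAr (linZ _ _ hf).
Qed.

Lemma alphaxl' L (f : A -> L) c : lin f ->
  \tens_(x1, x2 <- x) (α (c * x2) : k) *: f x1 = f c.
Proof.
move=> hf; rewrite (x_sym (f := fun a b => (α (c * a) : k) *: f b)) ?alphaxl //.
by lin.
Qed.

Lemma alpha_inj a b : (forall c, α (c * a) = α (c * b)) -> a = b.
Proof.
move=> E; rewrite -(alphaxr (f := id) a); last by lin.
rewrite -(alphaxr (f := id) b); last by lin.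
by tcongr; rewrite E.
Qed.

(** By duality of the bases x^1, x^2 for α, this is the trace of T. *)
Definition tr (T : A -> A) : k^o := \tens_(x1, x2 <- x) α (T x1 * x2).

(** With T and U expanded in the dual bases, both sides are the same double
    sum of matrix entries. *)
Lemma trC (T U : A -> A) : lin T -> lin U ->
  tr (fun a => T (U a)) = tr (fun a => U (T a)).
Proof.
move=> hT hU.
have E (P Q : A -> A) : lin P -> lin Q -> tr (fun a => P (Q a)) =
    \tens_(x1, x2 <- x) \tens_(y1, y2 <- x) α (Q x1 * y2) * α (P y1 * x2).
  move=> hP hQ; apply: eq_tlift => x1 x2.
  by rewrite -(alphaxl' (f := fun a => α (P a * x2))) //; lin.
rewrite !E // tlift_exch; apply: eq_tlift => x1 x2; apply: eq_tlift => y1 y2.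
exact: mulrC.
Qed.

(** The element x^1 x^2 = 1 is what makes α the trace of the regular
    representation, and not just some nondegenerate trace form. *)
Lemma alpha_tr a : α a = tr (fun b => a * b).
Proof.
rewrite -{1}[a]mulr1 -(x_mul (f := fun b => α (a * b))); last by lin.
by rewrite /tr; tcongr; rewrite mulrA.
Qed.
End Frobenius.

(** * Quantum commutative module algebras *)

Section Action.
Variables (k : fieldType) (H : falgType k) (HH : hopf H) (R : H ⊗ H).
Variables (A : falgType k) (M : module_algebra HH A).
Variables (x : A ⊗ A) (alpha : dual A).
Hypothesis hR : quasitriangular HH R.
Hypothesis hqc : quantum_commutative R M.
Hypothesis hx : symmetric_separability_idempotent x.
Hypothesis halpha : \tens_(x1, x2 <- x) ⟪alpha, x1⟫ *: x2 = 1.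
Hypothesis hu : forall a : A, act M (drinfeld HH R) a = a.
Implicit Types (L : lmodType k).
Local Notation Δ := (Delta HH).
Local Notation ε := (eps HH).
Local Notation S := (antipode HH).
Local Notation "h ⋅ a" := (act M h a) (at level 35, right associativity).
Local Notation α a := ⟪alpha, a⟫.

(** Since u acts trivially, so does the difference in u h = S^2(h) u. *)
Lemma actSS h a : S (S h) ⋅ a = h ⋅ a.
Proof. by rewrite -{1}[a]hu -actM -(drinfeldM hR) // actM hu. Qed.

Lemma act_mul_lift L (f : A -> L) h a b : lin f ->
  \tens_(h1, h2 <- Δ h) f ((h1 ⋅ a) * (h2 ⋅ b)) = f (h ⋅ (a * b)).
Proof. by move=> hf; rewrite act_mul (lin_tlift_comm _ _ hf). Qed.

Lemma act_Smul h a b :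
  S h ⋅ (a * b) = \tens_(h1, h2 <- Δ h) (S h2 ⋅ a) * (S h1 ⋅ b).
Proof.
rewrite act_mul (antipode_comul (f := fun p q => (p ⋅ a) * (q ⋅ b))) //.
by lin.
Qed.

(** As S^2 acts trivially, S(h_2) h_1 acts like S(h_2) S^2(h_1) = S(S(h_1) h_2).
    In a general Hopf algebra this contraction needs the inverse of S. *)
Lemma act_Sop L (f : A -> L) (G : H -> H -> L) h y :
  (forall a b, G a b = f (S b ⋅ a ⋅ y)) -> lin f ->
  \tens_(a, b <- Δ h) G a b = (ε h : k) *: f y.
Proof.
move=> E hf; apply: (contractl (f := fun z => f (S z ⋅ y))); last 2 first.
- by lin.
- by rewrite antipode1 act1.
by move=> a b; rewrite E antipodeM actM actSS.
Qed.

(** The mirror image, with h_2 S(h_1) acting like S(h_1 S(h_2)). *)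
Lemma act_Sop' L (f : A -> L) (G : H -> H -> L) h y :
  (forall a b, G a b = f (b ⋅ S a ⋅ y)) -> lin f ->
  \tens_(a, b <- Δ h) G a b = (ε h : k) *: f y.
Proof.
move=> E hf; apply: (contractr (f := fun z => f (S z ⋅ y))); last 2 first.
- by lin.
- by rewrite antipode1 act1.
by move=> a b; rewrite E antipodeM actM actSS.
Qed.

Lemma act_S L (f : A -> L) (G : H -> H -> L) h y :
  (forall a b, G a b = f (a ⋅ S b ⋅ y)) -> lin f ->
  \tens_(a, b <- Δ h) G a b = (ε h : k) *: f y.
Proof.
move=> E hf; apply: (contractr (f := fun z => f (z ⋅ y))); last 2 first.
- by lin.
- by rewrite act1.
by move=> a b; rewrite E actM.
Qed.

(** By the Leibniz rule h_1 meets S(h_2) on the second factor. *)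
Lemma act_Smul_absorb L (f : A -> L) d y h : lin f ->
  \tens_(h1, h2 <- Δ h) f (S h2 ⋅ (d * (h1 ⋅ y))) = f ((S h ⋅ d) * y).
Proof.
move=> hf.
transitivity (\tens_(h1, t <- Δ h) \tens_(h2, h3 <- Δ t)
   f ((S h3 ⋅ d) * (S h2 ⋅ h1 ⋅ y))).
  by apply: eq_tlift => h1 t; rewrite act_Smul (lin_tlift_comm _ _ hf).
apply: (cancel_l (g := fun h3 => f ((S h3 ⋅ d) * y))); [lin|lin|].
by move=> t c; apply: (act_Sop (f := fun y => f ((S c ⋅ d) * y))) => //; lin.
Qed.

Lemma act_mul_absorb L (f : A -> L) d y h : lin f ->
  \tens_(h1, h2 <- Δ h) f (h1 ⋅ (d * (S h2 ⋅ y))) = f ((h ⋅ d) * y).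
Proof.
move=> hf.
transitivity (\tens_(t, h3 <- Δ h) \tens_(h1, h2 <- Δ t)
   f ((h1 ⋅ d) * (h2 ⋅ S h3 ⋅ y))).
  by apply: eq_tlift => t h3; rewrite act_mul (lin_tlift_comm _ _ hf).
rewrite coassoc; last by lin.
apply: (cancel_r (g := fun h1 => f ((h1 ⋅ d) * y))); first by lin.
by move=> a t; apply: (act_S (f := fun y => f ((a ⋅ d) * y))) => //; lin.
Qed.

(** Left multiplication by h·a is b |-> h_1·(a (S(h_2)·b)); a cyclic
    permutation under the trace brings S(h_2) next to h_1, where they cancel. *)
Lemma alpha_act h a : α (h ⋅ a) = ε h * α a :> k^o.
Proof.
rewrite (alpha_tr alpha hx (h ⋅ a)).
transitivity (\tens_(h1, h2 <- Δ h) tr x alpha (fun b => h1 ⋅ (a * (S h2 ⋅ b)))).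
  rewrite /tr tlift_exch; apply: eq_tlift => x1 x2.
  by rewrite (act_mul_absorb (f := fun y => α (y * x2))) //; lin.
transitivity (\tens_(h1, h2 <- Δ h) tr x alpha (fun b => a * (S h2 ⋅ h1 ⋅ b))).
  apply: eq_tlift => h1 h2.
  by rewrite (trC hx halpha (T := fun b => h1 ⋅ b) (U := fun b => a * (S h2 ⋅ b))) //; lin.
rewrite /tr tlift_exch (alpha_tr alpha hx) /tr.
transitivity (\tens_(x1, x2 <- x) (ε h : k) *: (α (a * x1 * x2) : k^o)).
  apply: eq_tlift => x1 x2.
  by apply: (act_Sop (f := fun y => α (a * y * x2))) => //; lin.
by rewrite -scale_tlift.
Qed.

(** Write (h·a) b as h_1·(a (S(h_2)·b)) and use the invariance of α. *)
Lemma alpha_adj h a b : α ((h ⋅ a) * b) = α (a * (S h ⋅ b)).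
Proof.
rewrite -(act_mul_absorb (f := fun y => α y)); last by lin.
transitivity (\tens_(h1, h2 <- Δ h) (ε h1 : k) *: α (a * (S h2 ⋅ b))).
  by tcongr; rewrite alpha_act.
by rewrite counitl //; lin.
Qed.

Lemma alpha_adj' h a b : α ((S h ⋅ a) * b) = α (a * (h ⋅ b)).
Proof. by rewrite alpha_adj actSS. Qed.

(** Adjointness of h and S(h), read in the dual bases. *)
Lemma x_act L (f : A -> A -> L) h : bilin f ->
  \tens_(x1, x2 <- x) f (h ⋅ x1) x2 = \tens_(x1, x2 <- x) f x1 (S h ⋅ x2).
Proof.
move=> hf.
transitivity (\tens_(x1, x2 <- x) \tens_(y1, y2 <- x)
   (α (x1 * (S h ⋅ y2)) : k) *: f y1 x2).
  apply: eq_tlift => x1 x2.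
  rewrite -(alphaxl' hx halpha (f := fun a => f a x2)); last by lin.
  by tcongr; rewrite alpha_adj.
rewrite tlift_exch; apply: eq_tlift => y1 y2.
by rewrite (alphaxr hx halpha (f := fun a => f y1 a)) //; lin.
Qed.

Lemma x_act' L (f : A -> A -> L) h : bilin f ->
  \tens_(x1, x2 <- x) f (S h ⋅ x1) x2 = \tens_(x1, x2 <- x) f x1 (h ⋅ x2).
Proof. by move=> hf; rewrite x_act //; tcongr; rewrite actSS. Qed.

(** S(u) is adjoint to u, which is the identity, and the form is
    nondegenerate. *)
Lemma act_Su b : S (drinfeld HH R) ⋅ b = b.
Proof. by apply: (alpha_inj hx halpha) => c; rewrite -alpha_adj hu. Qed.

(** On A, S(R^1) R^2 acts like S(R^1) S^2(R^2) = S(S(R^2) R^1) = S(u). *)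
Lemma R_act_antipode L (f : A -> L) b : lin f ->
  \tens_(r1, r2 <- R) f (S r1 ⋅ r2 ⋅ b) = f b.
Proof.
move=> hf; rewrite -{2}[b]act_Su /drinfeld !lapp_tlift lfun_tliftl.
by rewrite (lin_tlift_comm _ _ hf); tcongr; rewrite antipodeM actM actSS.
Qed.

(** Quantum commutativity says that the product absorbs the braiding of A;
    this is the same for the inverse braiding, given by R^-1 = S(R^1) ⊗ R^2. *)
Lemma qc_inv L (f : A -> L) e y : lin f ->
  \tens_(r1, r2 <- R) f ((S r1 ⋅ e) * (r2 ⋅ y)) = f (y * e).
Proof.
move=> hf.
transitivity (\tens_(s1, s2 <- R) \tens_(r1, r2 <- R)
   f (((r2 * s2) ⋅ y) * ((r1 * S s1) ⋅ e))).
  apply: eq_tlift => s1 s2; rewrite hqc (lin_tlift_comm _ _ hf).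
  by tcongr; rewrite !actM.
rewrite tlift_exch (R_invr hR (f := fun a b => f ((b ⋅ y) * (a ⋅ e)))); last by lin.
by rewrite !act1.
Qed.

(** Expanding the coproduct of R^1 produces three copies of R: one acts by
    S(R^1) R^2 and disappears, one exchanges the two factors by [qc_inv], and
    one is left. *)
Lemma qc_twist L (f : A -> H -> L) e b : bilin f ->
  \tens_(r1, r2 <- R) \tens_(p, q <- Δ r1) f (S p ⋅ (e * (r2 ⋅ b))) q
  = \tens_(r1, r2 <- R) f ((r2 ⋅ b) * e) r1.
Proof.
move=> hf.
transitivity (\tens_(t1, t2 <- R) \tens_(r1, r2 <- R)
   f (S t1 ⋅ (e * (t2 ⋅ r2 ⋅ b))) r1).
  rewrite (R_Deltal hR (f := fun p q r => f (S p ⋅ (e * (r ⋅ b))) q)); last by lin.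
  by tcongr; rewrite actM.
rewrite tlift_exch; apply: eq_tlift => r1 r2.
transitivity (\tens_(t1, t2 <- R) \tens_(p, q <- Δ t1)
   f ((S q ⋅ e) * (S p ⋅ t2 ⋅ r2 ⋅ b)) r1).
  apply: eq_tlift => t1 t2; rewrite act_Smul.
  by rewrite (lin_tlift_comm (g := fun a => f a r1)) //; lin.
rewrite (R_Deltal hR (f := fun p q t => f ((S q ⋅ e) * (S p ⋅ t ⋅ r2 ⋅ b)) r1));
  last by lin.
rewrite tlift_exch.
transitivity (\tens_(s1, s2 <- R) f ((S s1 ⋅ e) * (s2 ⋅ r2 ⋅ b)) r1).
  apply: eq_tlift => s1 s2.
  under eq_tlift do rewrite actM.
  by rewrite (R_act_antipode (f := fun y => f ((S s1 ⋅ e) * y) r1)) //; lin.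
by rewrite (qc_inv (f := fun y => f y r1)) //; lin.
Qed.

(** In the second leg the product is opposite to that of R^-1 R, but trivial
    action of S^2 allows applying S there, and S reverses products. *)
Lemma R_cancel_act L (f : H -> A -> L) y : bilin f ->
  \tens_(r1, r2 <- R) \tens_(s1, s2 <- R) f (S r1 * s1) (s2 ⋅ r2 ⋅ y) = f 1 y.
Proof.
move=> hf.
transitivity (\tens_(r1, r2 <- R) \tens_(s1, s2 <- R)
   f (S r1 * s1) (S (S r2 * S s2) ⋅ y)).
  by tcongr; rewrite antipodeM !actM !actSS.
rewrite (R_SS hR (f := fun r1 r2 => \tens_(s1, s2 <- R)
   f (r1 * s1) (S (r2 * S s2) ⋅ y))); last by lin.
transitivity (\tens_(r1, r2 <- R) \tens_(s1, s2 <- R)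
   f (r1 * S s1) (S (r2 * S (S s2)) ⋅ y)).
  apply: eq_tlift => r1 r2; symmetry.
  by apply: (R_SS hR (f := fun s1 s2 => f (r1 * s1) (S (r2 * S s2) ⋅ y))); lin.
transitivity (\tens_(r1, r2 <- R) \tens_(s1, s2 <- R)
   f (r1 * S s1) (S (r2 * s2) ⋅ y)).
  by tcongr; rewrite !antipodeM !actM !actSS.
rewrite (R_invr hR (f := fun a b => f a (S b ⋅ y))); last by lin.
by rewrite antipode1 act1.
Qed.

(** The Leibniz rule for S(h_1), then [R_conj] on the factor that meets R. *)
Lemma R_slide L (f : A -> H -> L) d e h : bilin f ->
  \tens_(s1, s2 <- R) \tens_(h1, h2 <- Δ h)
    f (S h1 ⋅ ((s2 ⋅ d) * e)) (s1 * h2)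
  = \tens_(h1, t <- Δ h) \tens_(h2, h3 <- Δ t) \tens_(s1, s2 <- R)
    f ((s2 ⋅ S h3 ⋅ d) * (S h1 ⋅ e)) (h2 * s1).
Proof.
move=> hf.
transitivity (\tens_(s1, s2 <- R) \tens_(h1, t <- Δ h) \tens_(h2, h3 <- Δ t)
    f (((S h2 * s2) ⋅ d) * (S h1 ⋅ e)) (s1 * h3)).
  apply: eq_tlift => s1 s2; rewrite -coassoc; last by lin.
  apply: eq_tlift => h1 h2; rewrite act_Smul.
  rewrite (lin_tlift_comm (g := fun a => f a (s1 * h2))); last by lin.
  by tcongr; rewrite actM.
rewrite tlift_exch; apply: eq_tlift => h1 t.
rewrite (R_conj hR (f := fun a b => f ((a ⋅ d) * (S h1 ⋅ e)) b)); last by lin.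
by rewrite tlift_exch; tcongr; rewrite actM.
Qed.

End Action.

(** * The weak Hopf algebra B as operators on A *)

Section Phi.
Variables (k : fieldType) (H : falgType k) (HH : hopf H) (R : H ⊗ H).
Variables (A : falgType k) (M : module_algebra HH A).
Variables (x : A ⊗ A) (alpha : dual A).
Hypothesis hR : quasitriangular HH R.
Hypothesis hqc : quantum_commutative R M.
Hypothesis hx : symmetric_separability_idempotent x.
Hypothesis halpha : \tens_(x1, x2 <- x) ⟪alpha, x1⟫ *: x2 = 1.
Hypothesis hu : forall a : A, act M (drinfeld HH R) a = a.
Implicit Types (L : lmodType k).
Local Notation Δ := (Delta HH).
Local Notation ε := (eps HH).
Local Notation S := (antipode HH).
Local Notation "h ⋅ a" := (act M h a) (at level 35, right associativity).
Local Notation α a := ⟪alpha, a⟫.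
Local Notation BT := (A ⊗ H ⊗ dual A)%type.
Local Notation φ := (phi M x alpha).

(** The operator c |-> f(c) a attached to a ⊗ h ⊗ f, with the leg in H carried
    along. *)
Definition evalB (t : BT) (c : A) : (A ⊗ H)%type :=
  \tens_(a, y <- t) \tens_(h, f <- y) ⟪f, c⟫ *: (a ⊗ h).

Definition evalBB (T : (BT ⊗ BT)%type) (c d : A) : ((A ⊗ H) ⊗ (A ⊗ H))%type :=
  \tens_(s, t <- T) evalB s c ⊗ evalB t d.

Lemma evalB_bilin : bilin evalB.
Proof. by rewrite /evalB; lin. Qed.

Lemma evalBE a h f c : evalB (a ⊗ h ⊗ f) c = ⟪f, c⟫ *: (a ⊗ h).
Proof. by rewrite /evalB tliftE3 //; lin. Qed.

(** Serves to recover t from its values: t is the sum of [coevalB x^2] applied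
    to the value of t at x^1. *)
Definition coevalB (b : A) (z : (A ⊗ H)%type) : BT :=
  \tens_(a, h <- z) a ⊗ h ⊗ hitl b alpha.

Lemma coevalB_bilin : bilin coevalB.
Proof. by rewrite /coevalB; lin. Qed.

(** At c this is f applied to the expansion of c in the dual bases. *)
Lemma dual_x (f : dual A) : \tens_(x1, x2 <- x) ⟪f, x1⟫ *: hitl x2 alpha = f.
Proof.
apply/lfunP => c; rewrite -[LHS]/(ev _ c) -[RHS]/(ev f c).
rewrite (lin_tlift_comm (g := fun f => ev f c)); last by lin.
rewrite -[RHS](alphaxl' hx halpha (f := fun a => ev f a)); last by lin.
apply: eq_tlift => x1 x2; rewrite (linZ (f := fun f => ev f c)); last by lin.
by rewrite hitlE -[LHS]/(_ * _) -[RHS]/(_ * _) mulrC.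
Qed.

Lemma evalBK t : \tens_(x1, x2 <- x) coevalB x2 (evalB t x1) = t.
Proof.
have h1 := coevalB_bilin; have h2 := evalB_bilin.
apply: (tens_ext3 (f := fun t => \tens_(x1, x2 <- x) coevalB x2 (evalB t x1))); [lin|lin|].
move=> a h f; rewrite -[in RHS](dual_x f) !tpure_tliftr.
apply: eq_tlift => x1 x2; rewrite evalBE.
rewrite (linZ (f := coevalB x2)); last by lin.
rewrite /coevalB tliftE; last by lin.
by rewrite (linZ (f := fun f => a ⊗ h ⊗ f)) //; lin.
Qed.

Lemma evalB_inj s t : (forall c, evalB s c = evalB t c) -> s = t.
Proof. by move=> E; rewrite -[s]evalBK -[t]evalBK; tcongr; rewrite E. Qed.

Lemma evalBB_inj s t : (forall c d, evalBB s c d = evalBB t c d) -> s = t.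
Proof.
have h1 := coevalB_bilin; have h2 := evalB_bilin.
suff K T : \tens_(x1, x2 <- x) \tens_(y1, y2 <- x)
    \tens_(s, t <- evalBB T x1 y1) coevalB x2 s ⊗ coevalB y2 t = T.
  by move=> E; rewrite -[s]K -[t]K; tcongr; rewrite E.
apply: (tens_ext (f := fun T => \tens_(x1, x2 <- x) \tens_(y1, y2 <- x)
    \tens_(s, t <- evalBB T x1 y1) coevalB x2 s ⊗ coevalB y2 t)).
- by rewrite /evalBB; lin.
- by lin.
move=> u v; rewrite -{2}[u]evalBK tpure_tliftl; apply: eq_tlift => x1 x2.
rewrite -{2}[v]evalBK tpure_tliftr; apply: eq_tlift => y1 y2.
by rewrite /evalBB tliftE ?tliftE //; lin.
Qed.

(** * The map φ *)

Lemma phi_lin : lin φ.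
Proof. by rewrite /phi; lin. Qed.

(** Summing the factor α(c x^2) against x^1 replaces x^1 by c. *)
Lemma evalB_phi a h c :
  evalB (φ (a ⊗ h)) c = \tens_(h1, h2 <- Δ h) (S h1 ⋅ (c * a)) ⊗ h2.
Proof.
have h2 := evalB_bilin.
rewrite /phi tliftE; last by lin.
rewrite tlift_exch (lin_tlift_comm (g := fun t => evalB t c)); last by lin.
apply: eq_tlift => h1 h'; rewrite (lin_tlift_comm (g := fun t => evalB t c)); last by lin.
rewrite -(alphaxl' hx halpha (f := fun b => (S h1 ⋅ (b * a)) ⊗ h')); last by lin.
by tcongr; rewrite evalBE hitlE.
Qed.

Lemma smash_mul_bilin : bilin (smash_mul M).
Proof. by rewrite /smash_mul; lin. Qed.

Lemma smash_mulE a h b g : smash_mul M (a ⊗ h) (b ⊗ g)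
  = \tens_(h1, h2 <- Δ h) (a * (h1 ⋅ b)) ⊗ (h2 * g).
Proof. by rewrite /smash_mul tliftE ?tliftE //; lin. Qed.

Lemma B_mul_bilin : bilin (@B_mul k H A).
Proof. by rewrite /B_mul; lin. Qed.

(** In terms of operators, the product of B is composition in reversed order. *)
Lemma evalB_mul s t c : evalB (B_mul s t) c =
  \tens_(a, h <- evalB s c) \tens_(b, g <- evalB t a) b ⊗ (h * g).
Proof.
have h1 := B_mul_bilin; have h2 := evalB_bilin.
apply: (tens_ext3 (f := fun s => evalB (B_mul s t) c) (g := fun s =>
  \tens_(a, h <- evalB s c) \tens_(b, g <- evalB t a) b ⊗ (h * g))); [lin|lin|].
move=> a h f.
apply: (tens_ext3 (f := fun t => evalB (B_mul (a ⊗ h ⊗ f) t) c) (g := fun t =>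
  \tens_(a, h <- evalB (a ⊗ h ⊗ f) c) \tens_(b, g <- evalB t a) b ⊗ (h * g))); [lin|lin|].
move=> b g f'; rewrite evalBE tliftZ tliftE; last by lin.
rewrite evalBE tliftZ tliftE; last by lin.
rewrite /B_mul tliftE3; last by lin.
rewrite tliftE3; last by lin.
rewrite (linZ (f := fun t => evalB t c)) ?evalBE ?scalerA 1?mulrC //; lin.
Qed.

(** Only [act_Smul_absorb], with d = c a and y = b, is not formal. *)
Lemma phi_mul s t : φ (smash_mul M s t) = B_mul (φ s) (φ t).
Proof.
have h1 := B_mul_bilin; have h2 := evalB_bilin; have h3 := smash_mul_bilin.
have h4 := phi_lin.
apply: (tens_ext (f := fun s => φ (smash_mul M s t))
  (g := fun s => B_mul (φ s) (φ t))); [lin|lin|] => a h.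
apply: (tens_ext (f := fun t => φ (smash_mul M (a ⊗ h) t))
  (g := fun t => B_mul (φ (a ⊗ h)) (φ t))); [lin|lin|] => b g.
apply: evalB_inj => c; rewrite evalB_mul evalB_phi tlift_tlift smash_mulE.
rewrite (lin_tlift_comm (g := fun t => evalB (φ t) c)); last by lin.
transitivity (\tens_(h1, t <- Δ h) \tens_(h21, h22 <- Δ t) \tens_(g1, g2 <- Δ g)
  (S g1 ⋅ S h21 ⋅ (c * a * (h1 ⋅ b))) ⊗ (h22 * g2)).
  apply: eq_tlift => h1' h2'; rewrite evalB_phi DeltaM_lift; last by lin.
  by tcongr; rewrite antipodeM actM !mulrA.
rewrite -coassoc; last by lin.
apply: eq_tlift => h1' h2'; rewrite tliftE; last by lin.
rewrite evalB_phi tlift_tlift tlift_exch; apply: eq_tlift => g1 g2.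
rewrite tliftE; last by lin.
by rewrite (act_Smul_absorb hR hu (f := fun y => (S g1 ⋅ y) ⊗ (h2' * g2))) //; lin.
Qed.

Lemma phi_one : φ (smash_one H A) = B_one H x alpha.
Proof.
rewrite /smash_one /phi tliftE; last by lin.
apply: eq_tlift => x1 x2; rewrite Delta1_lift; last by lin.
by rewrite antipode1 act1 mulr1.
Qed.

Lemma phi_counit t : B_counit HH alpha (φ t) = smash_counit HH alpha t.
Proof.
have h4 := phi_lin.
apply: (tens_ext (f := fun t => B_counit HH alpha (φ t) : k^o)
  (g := fun t => smash_counit HH alpha t : k^o)).
- by rewrite /B_counit; lin.
- by rewrite /smash_counit; lin.
move=> a h; rewrite /smash_counit tliftE; last by lin.
rewrite /phi tliftE; last by lin.
rewrite (lin_tlift_comm (g := B_counit HH alpha : _ -> k^o)); last first.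
  by rewrite /B_counit; lin.
transitivity (\tens_(x1, x2 <- x) (α (1 * x2) : k) *: (ε h * α (x1 * a) : k^o)).
  apply: eq_tlift => x1 x2.
  rewrite (lin_tlift_comm (g := B_counit HH alpha : _ -> k^o)); last first.
    by rewrite /B_counit; lin.
  transitivity (\tens_(h1, h2 <- Δ h) (ε h2 : k) *: ((ε h1 * α (x1 * a)) * α (1 * x2) : k^o)).
    apply: eq_tlift => h1 h2; rewrite /B_counit tliftE3; last by lin.
    rewrite (alpha_act hR hx halpha hu) eps_antipode hitlE.
    by rewrite -[RHS]/(_ * _) mulrA [ε h2 * _]mulrC.
  rewrite (counitr (f := fun h1 => ε h1 * α (x1 * a) * α (1 * x2))); last by lin.
  by rewrite mulrC.
rewrite (alphaxl' hx halpha (f := fun b => ε h * α (b * a))); last by lin.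
by rewrite mul1r mulrC.
Qed.

Lemma B_comul_lin : lin (B_comul R M x).
Proof. by rewrite /B_comul; lin. Qed.

(** The two halves of the coproduct of f are evaluated at c and at R_2^2·d, so
    they recombine to f evaluated at a product. *)
Lemma evalBB_comul t c d : evalBB (B_comul R M x t) c d =
  \tens_(r1, r2 <- R) \tens_(s1, s2 <- R) \tens_(x1, x2 <- x)
  \tens_(a, h <- evalB t ((s2 ⋅ d) * c)) \tens_(h1, h2 <- Δ h)
    (((r2 ⋅ x1) * a) ⊗ (s1 * h1 * r1)) ⊗ (x2 ⊗ h2).
Proof.
have h1 := B_comul_lin; have h2 := evalB_bilin.
have h3 : lin (fun T => evalBB T c d) by rewrite /evalBB; lin.
apply: (tens_ext3 (f := fun t => evalBB (B_comul R M x t) c d) (g := fun t =>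
  \tens_(r1, r2 <- R) \tens_(s1, s2 <- R) \tens_(x1, x2 <- x)
  \tens_(a, h <- evalB t ((s2 ⋅ d) * c)) \tens_(h1, h2 <- Δ h)
    (((r2 ⋅ x1) * a) ⊗ (s1 * h1 * r1)) ⊗ (x2 ⊗ h2))).
- exact: (lin_comp h3 h1).
- by lin.
move=> a h f; rewrite /B_comul tliftE3; last by lin.
do 3 (rewrite (lin_tlift_comm _ _ h3); apply: eq_tlift => ? ?).
rewrite evalBE tliftZ tliftE; last by lin.
rewrite (lin_tlift_comm _ _ h3) scale_tlift; apply: eq_tlift => p q.
rewrite (lin_tlift_comm _ _ h3) -dual_comulE scale_tliftl; apply: eq_tlift => f1 f2.
rewrite /evalBB tliftE; last by lin.
rewrite !evalBE dactE.
by rewrite tpureZl tpureZr scalerA mulrC.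
Qed.

Lemma smash_comul_lin : lin (smash_comul R M x).
Proof. by rewrite /smash_comul; lin. Qed.

(** Both sides are brought to the normal form K.  On either side [R_slide]
    moves S(h_1) across a factor acted on by R: the factor d on the side of B,
    the leg x^1 on the other. *)
Lemma phi_comul t : B_comul R M x (φ t)
  = \tens_(t1, t2 <- smash_comul R M x t) φ t1 ⊗ φ t2.
Proof.
have l1 := B_comul_lin; have l2 := evalB_bilin; have l3 := phi_lin.
have l4 := smash_comul_lin.
apply: (tens_ext (f := fun t => B_comul R M x (φ t))
  (g := fun t => \tens_(t1, t2 <- smash_comul R M x t) φ t1 ⊗ φ t2)); [lin|lin|].
move=> {t} a h; apply: evalBB_inj => c d; set e := c * a.
pose K := \tens_(m, q <- Δ h) \tens_(h1, t <- Δ m) \tens_(h2, h3 <- Δ t)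
  \tens_(r1, r2 <- R) \tens_(x1, x2 <- x)
  (((r2 ⋅ x1) * (S h1 ⋅ e)) ⊗ (h2 * r1)) ⊗ (((S h3 ⋅ d) * x2) ⊗ q).
transitivity K; rewrite /K.
  (* The two copies of R merge into the coproduct of R^2, which then acts on
     the product x^1 (S(h_3)·d); here S(h_3)·d may pass to the leg x^2. *)
  rewrite evalBB_comul.
  transitivity (\tens_(m, q <- Δ h) \tens_(r1, r2 <- R) \tens_(x1, x2 <- x)
    \tens_(s1, s2 <- R) \tens_(h1, p <- Δ m)
    (((r2 ⋅ x1) * (S h1 ⋅ ((s2 ⋅ d) * e))) ⊗ (s1 * p * r1)) ⊗ (x2 ⊗ q)).
    rewrite [RHS]tlift_exch; apply: eq_tlift => r1 r2.
    rewrite [RHS]tlift_exch [LHS]tlift_exch; apply: eq_tlift => x1 x2.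
    rewrite [RHS]tlift_exch; apply: eq_tlift => s1 s2.
    rewrite evalB_phi tlift_tlift coassoc; last by lin.
    apply: eq_tlift => h1 h2; rewrite tliftE; last by lin.
    by tcongr; rewrite /e !mulrA.
  apply: eq_tlift => m q.
  transitivity (\tens_(r1, r2 <- R) \tens_(x1, x2 <- x)
    \tens_(h1, t <- Δ m) \tens_(h2, h3 <- Δ t) \tens_(s1, s2 <- R)
    (((r2 ⋅ x1) * ((s2 ⋅ S h3 ⋅ d) * (S h1 ⋅ e))) ⊗ (h2 * s1 * r1)) ⊗ (x2 ⊗ q)).
    apply: eq_tlift => r1 r2; apply: eq_tlift => x1 x2.
    by apply: (R_slide M hR (f := fun y g => (((r2 ⋅ x1) * y) ⊗ (g * r1)) ⊗ (x2 ⊗ q))); lin.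
  under eq_tlift do rewrite tlift_exch.
  rewrite tlift_exch; apply: eq_tlift => h1 t.
  under eq_tlift do rewrite tlift_exch.
  rewrite tlift_exch; apply: eq_tlift => h2 h3.
  rewrite tlift_exch [RHS]tlift_exch.
  transitivity (\tens_(x1, x2 <- x) \tens_(r1, r2 <- R)
    (((r2 ⋅ (x1 * (S h3 ⋅ d))) * (S h1 ⋅ e)) ⊗ (h2 * r1)) ⊗ (x2 ⊗ q)).
    apply: eq_tlift => x1 x2; symmetry.
    transitivity (\tens_(r1, r2 <- R) \tens_(p, p' <- Δ r2)
      (((p ⋅ x1) * (p' ⋅ S h3 ⋅ d) * (S h1 ⋅ e)) ⊗ (h2 * r1)) ⊗ (x2 ⊗ q)).
      apply: eq_tlift => r1 r2; symmetry.
      by apply: (act_mul_lift M (f := fun y => ((y * (S h1 ⋅ e)) ⊗ (h2 * r1)) ⊗ (x2 ⊗ q))); lin.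
    rewrite (R_Deltar hR (f := fun a b c => (((b ⋅ x1) * (c ⋅ S h3 ⋅ d) *
      (S h1 ⋅ e)) ⊗ (h2 * a)) ⊗ (x2 ⊗ q))); last by lin.
    by rewrite tlift_exch; tcongr; rewrite !mulrA.
  rewrite (x_sep' hx (f := fun x1 x2 => \tens_(r1, r2 <- R)
    (((r2 ⋅ x1) * (S h1 ⋅ e)) ⊗ (h2 * r1)) ⊗ (x2 ⊗ q))) //; lin.
symmetry.
have l5 : lin (fun T => evalBB T c d) by rewrite /evalBB; lin.
transitivity (\tens_(t1, t2 <- smash_comul R M x (a ⊗ h)) evalB (φ t1) c ⊗ evalB (φ t2) d).
  rewrite (lin_tlift_comm _ _ l5); apply: eq_tlift => t1 t2.
  by rewrite /evalBB tliftE //; lin.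
rewrite /smash_comul tliftE; last by lin.
rewrite !tlift_tlift.
transitivity (\tens_(h1, h2 <- Δ h) \tens_(p, q <- Δ h2) \tens_(x1, x2 <- x)
  \tens_(r1, r2 <- R) \tens_(g1, g2 <- Δ h1)
  ((S g1 ⋅ ((r2 ⋅ x1) * e)) ⊗ (r1 * g2)) ⊗ ((S p ⋅ (d * x2)) ⊗ q)).
  transitivity (\tens_(h1, h2 <- Δ h) \tens_(x1, x2 <- x) \tens_(r1, r2 <- R)
    evalB (φ ((a * (r2 ⋅ x1)) ⊗ (r1 * h1))) c ⊗ evalB (φ (x2 ⊗ h2)) d).
    rewrite [RHS]tlift_exch; under [RHS]eq_tlift do rewrite tlift_exch.
    rewrite [RHS]tlift_exch; apply: eq_tlift => r1 r2.
    rewrite !tlift_tlift; apply: eq_tlift => x1 x2.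
    by rewrite !tlift_tlift; apply: eq_tlift => h1 h2; rewrite tliftE //; lin.
  apply: eq_tlift => h1 h2; rewrite [RHS]tlift_exch; apply: eq_tlift => x1 x2.
  transitivity (\tens_(p, q <- Δ h2) \tens_(g1, g2 <- Δ h1) \tens_(r1, r2 <- R)
    \tens_(p1, p2 <- Δ r1) ((S g1 ⋅ S p1 ⋅ (e * (r2 ⋅ x1))) ⊗ (p2 * g2))
      ⊗ ((S p ⋅ (d * x2)) ⊗ q)).
    under [RHS]eq_tlift do rewrite tlift_exch.
    rewrite [RHS]tlift_exch; apply: eq_tlift => r1 r2.
    rewrite !evalB_phi tpure_tliftr; apply: eq_tlift => p q.
    rewrite tpure_tliftl DeltaM_lift; last by lin.
    by rewrite tlift_exch; tcongr; rewrite antipodeM actM /e !mulrA.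
  apply: eq_tlift => p q; rewrite [RHS]tlift_exch; apply: eq_tlift => g1 g2.
  by rewrite (qc_twist hR hqc hx halpha hu (f := fun y v => ((S g1 ⋅ y) ⊗ (v * g2))
      ⊗ ((S p ⋅ (d * x2)) ⊗ q))) //; lin.
(* By invariance of x, the action of S(g_3) on x^1 becomes that of g_3 on x^2,
   where it is absorbed by S(p). *)
rewrite -coassoc; last by lin.
apply: eq_tlift => m q.
pose W g1 g2 g3 p := \tens_(r1, r2 <- R) \tens_(x1, x2 <- x)
  (((r2 ⋅ x1) * (S g1 ⋅ e)) ⊗ (g2 * r1)) ⊗ ((S p ⋅ (d * (g3 ⋅ x2))) ⊗ q).
transitivity (\tens_(h1, p <- Δ m) \tens_(g1, t <- Δ h1) \tens_(g2, g3 <- Δ t)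
  W g1 g2 g3 p); rewrite /W.
  apply: eq_tlift => h1 p.
  transitivity (\tens_(x1, x2 <- x) \tens_(g1, t <- Δ h1) \tens_(g2, g3 <- Δ t)
    \tens_(r1, r2 <- R) (((r2 ⋅ S g3 ⋅ x1) * (S g1 ⋅ e)) ⊗ (g2 * r1))
       ⊗ ((S p ⋅ (d * x2)) ⊗ q)).
    apply: eq_tlift => x1 x2.
    by rewrite (R_slide M hR (f := fun y v => (y ⊗ v) ⊗ ((S p ⋅ (d * x2)) ⊗ q))) //; lin.
  rewrite tlift_exch; apply: eq_tlift => g1 t.
  rewrite tlift_exch; apply: eq_tlift => g2 g3.
  rewrite tlift_exch; apply: eq_tlift => r1 r2.
  by rewrite (x_act' hR hx halpha hu (f := fun x1 x2 =>
    (((r2 ⋅ x1) * (S g1 ⋅ e)) ⊗ (g2 * r1)) ⊗ ((S p ⋅ (d * x2)) ⊗ q))) //; lin.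
rewrite coassoc; last by lin.
apply: eq_tlift => g1 t; rewrite coassoc; last by lin.
apply: eq_tlift => g2 h3.
rewrite tlift_exch; apply: eq_tlift => r1 r2.
rewrite tlift_exch; apply: eq_tlift => x1 x2.
by rewrite (act_Smul_absorb hR hu (f := fun y => (((r2 ⋅ x1) * (S g1 ⋅ e)) ⊗ (g2 * r1))
  ⊗ (y ⊗ q))) //; lin.
Qed.

Lemma B_anti_lin : lin (B_anti R M x alpha).
Proof. by rewrite /B_anti; lin. Qed.

Lemma smash_antiE a h : smash_anti R M (a ⊗ h)
  = \tens_(r1, r2 <- R) \tens_(h1, h2 <- Δ h) (S h2 ⋅ r2 ⋅ a) ⊗ (S h1 * r1).
Proof.
have h3 := smash_mul_bilin.
rewrite /smash_anti tliftE; last by lin.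
apply: eq_tlift => r1 r2; rewrite smash_mulE antipode_comul; last by lin.
by tcongr; rewrite mul1r.
Qed.

Lemma evalB_anti t c : evalB (B_anti R M x alpha t) c =
  \tens_(r1, r2 <- R) \tens_(s1, s2 <- R) \tens_(x1, x2 <- x)
  \tens_(a, h <- evalB t (s2 ⋅ x1))
    (α ((r2 ⋅ a) * c) : k) *: (x2 ⊗ (r1 * S (s1 * h))).
Proof.
have h1 := B_anti_lin; have h2 := evalB_bilin.
have h3 : lin (fun t => evalB t c) by lin.
apply: (tens_ext3 (f := fun t => evalB (B_anti R M x alpha t) c) (g := fun t =>
  \tens_(r1, r2 <- R) \tens_(s1, s2 <- R) \tens_(x1, x2 <- x)
  \tens_(a, h <- evalB t (s2 ⋅ x1))
    (α ((r2 ⋅ a) * c) : k) *: (x2 ⊗ (r1 * S (s1 * h))))); [lin|lin|].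
move=> a h f; rewrite /B_anti tliftE3; last by lin.
do 3 (rewrite (lin_tlift_comm _ _ h3); apply: eq_tlift => ? ?).
rewrite evalBE tliftZ tliftE; last by lin.
by rewrite (linZ _ _ h3) evalBE hitrE dactE.
Qed.

Lemma smash_anti_lin : lin (smash_anti R M).
Proof. by rewrite /smash_anti; lin. Qed.

(** Both sides are brought to (R^2·a)(h_2·c) ⊗ S(h_1) R^1. *)
Lemma phi_anti t : φ (smash_anti R M t) = B_anti R M x alpha (φ t).
Proof.
have l1 := B_anti_lin; have l2 := evalB_bilin; have l3 := phi_lin.
have l4 := smash_anti_lin.
apply: (tens_ext (f := fun t => φ (smash_anti R M t))
  (g := fun t => B_anti R M x alpha (φ t))); [lin|lin|].
move=> {t} a h; apply: evalB_inj => c.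
transitivity (\tens_(h1, h2 <- Δ h) \tens_(r1, r2 <- R)
  ((r2 ⋅ a) * (h2 ⋅ c)) ⊗ (S h1 * r1)).
  rewrite smash_antiE (lin_tlift_comm (g := fun t => evalB (φ t) c)); last by lin.
  rewrite [RHS]tlift_exch.
  transitivity (\tens_(r1, r2 <- R) \tens_(h1, t <- Δ h) \tens_(h2, h3 <- Δ t)
    \tens_(p, q <- Δ r1) (S p ⋅ h2 ⋅ (c * (S h3 ⋅ r2 ⋅ a))) ⊗ (S h1 * q)).
    apply: eq_tlift => r1 r2.
    rewrite (lin_tlift_comm (g := fun t => evalB (φ t) c)); last by lin.
    rewrite -coassoc; last by lin.
    apply: eq_tlift => h1 h2; rewrite evalB_phi DeltaM_lift; last by lin.
    rewrite antipode_comul; last by lin.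
    by tcongr; rewrite antipodeM actM (actSS hR hu).
  transitivity (\tens_(r1, r2 <- R) \tens_(h1, t <- Δ h)
    \tens_(p, q <- Δ r1) (S p ⋅ ((t ⋅ c) * (r2 ⋅ a))) ⊗ (S h1 * q)).
    apply: eq_tlift => r1 r2; apply: eq_tlift => h1 t.
    by rewrite (act_mul_absorb M (f := fun y => \tens_(p, q <- Δ r1)
       (S p ⋅ y) ⊗ (S h1 * q))) //; lin.
  rewrite tlift_exch [RHS]tlift_exch; apply: eq_tlift => h1 h2.
  by rewrite (qc_twist hR hqc hx halpha hu (f := fun y v => y ⊗ (S h1 * v))) //; lin.
(* On the side of B, adjointness turns the operator into
   c |-> S(R_2^2)·(a (h_1·S(R_1^2)·c)).  By (S ⊗ S)(R) = R the antipodes move to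
   the leg in H; the coproduct of R_2^2 splits R_2 into two copies, one of which
   cancels R_1. *)
symmetry; rewrite evalB_anti.
transitivity (\tens_(r1, r2 <- R) \tens_(s1, s2 <- R) \tens_(h1, h2 <- Δ h)
  (S s2 ⋅ (a * (h1 ⋅ S r2 ⋅ c))) ⊗ (r1 * (S h2 * S s1))).
  apply: eq_tlift => r1 r2; apply: eq_tlift => s1 s2.
  transitivity (\tens_(x1, x2 <- x) \tens_(h1, h2 <- Δ h)
    (α (x1 * (S s2 ⋅ (a * (h1 ⋅ S r2 ⋅ c)))) : k) *: (x2 ⊗ (r1 * (S h2 * S s1)))).
    apply: eq_tlift => x1 x2; rewrite evalB_phi tlift_tlift; apply: eq_tlift => h1 h2.
    rewrite tliftE; last by lin.
    rewrite antipodeM (alpha_adj hR hx halpha hu) (alpha_adj' hR hx halpha hu).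
    by rewrite -mulrA (alpha_adj hR hx halpha hu).
  rewrite tlift_exch; apply: eq_tlift => h1 h2.
  by rewrite (alphaxr hx halpha (f := fun y => y ⊗ (r1 * (S h2 * S s1)))) //; lin.
transitivity (\tens_(r1, r2 <- R) \tens_(s1, s2 <- R) \tens_(h1, h2 <- Δ h)
  (s2 ⋅ (a * (h1 ⋅ S r2 ⋅ c))) ⊗ (r1 * (S h2 * s1))).
  apply: eq_tlift => r1 r2.
  by rewrite (R_SS hR (f := fun s1 s2 => \tens_(h1, h2 <- Δ h)
    (s2 ⋅ (a * (h1 ⋅ S r2 ⋅ c))) ⊗ (r1 * (S h2 * s1)))) //; lin.
rewrite -(R_SS hR (f := fun r1 r2 => \tens_(s1, s2 <- R) \tens_(h1, h2 <- Δ h)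
  (s2 ⋅ (a * (h1 ⋅ S r2 ⋅ c))) ⊗ (r1 * (S h2 * s1)))); last by lin.
transitivity (\tens_(s1, s2 <- R) \tens_(r1, r2 <- R) \tens_(h1, h2 <- Δ h)
  (s2 ⋅ (a * ((h1 * r2) ⋅ c))) ⊗ (S (h2 * r1) * s1)).
  by rewrite tlift_exch; tcongr; rewrite antipodeM !actM (actSS hR hu) !mulrA.
transitivity (\tens_(s1, s2 <- R) \tens_(r1, r2 <- R) \tens_(h1, h2 <- Δ h)
  (s2 ⋅ (a * ((r2 * h2) ⋅ c))) ⊗ (S (r1 * h1) * s1)).
  apply: eq_tlift => s1 s2; symmetry.
  by apply: (R_comul hR (f := fun u v => (s2 ⋅ (a * (v ⋅ c))) ⊗ (S u * s1))); lin.
under eq_tlift do rewrite tlift_exch.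
rewrite tlift_exch; apply: eq_tlift => h1 h2; rewrite tlift_exch.
transitivity (\tens_(r1, r2 <- R) \tens_(s1, s2 <- R) \tens_(t1, t2 <- R)
  ((t2 ⋅ a) * (s2 ⋅ r2 ⋅ h2 ⋅ c)) ⊗ (S h1 * (S r1 * s1 * t1))).
  apply: eq_tlift => r1 r2.
  transitivity (\tens_(s1, s2 <- R) \tens_(p, q <- Δ s2)
    ((p ⋅ a) * (q ⋅ r2 ⋅ h2 ⋅ c)) ⊗ (S h1 * (S r1 * s1))).
    apply: eq_tlift => s1 s2; rewrite actM antipodeM -mulrA; symmetry.
    by apply: (act_mul_lift M (f := fun y => y ⊗ (S h1 * (S r1 * s1)))); lin.
  rewrite (R_Deltar hR (f := fun a' p q =>
    ((p ⋅ a) * (q ⋅ r2 ⋅ h2 ⋅ c)) ⊗ (S h1 * (S r1 * a')))); last by lin.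
  by tcongr; rewrite !mulrA.
rewrite (R_cancel_act hR hu (f := fun u y => \tens_(t1, t2 <- R)
  ((t2 ⋅ a) * y) ⊗ (S h1 * (u * t1)))); last by lin.
by tcongr; rewrite mul1r.
Qed.

(** At c = 1 the operator φ(a # h) gives S(h_1)·a ⊗ h_2, from which
    b ⊗ g |-> g_1·b ⊗ g_2 recovers a ⊗ h. *)
Lemma phi_inj : injective φ.
Proof.
have l2 := evalB_bilin; have l3 := phi_lin.
pose psi (z : (A ⊗ H)%type) := \tens_(b, g <- z) \tens_(g1, g2 <- Δ g) (g1 ⋅ b) ⊗ g2.
have l4 : lin psi by rewrite /psi; lin.
apply: (can_inj (g := fun z => psi (evalB z 1))) => t.
apply: (tens_ext (f := fun t => psi (evalB (φ t) 1)) (g := id)); [lin|lin|].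
move=> {t} a h; rewrite evalB_phi (lin_tlift_comm _ _ l4).
transitivity (\tens_(h1, t <- Δ h) \tens_(h2, h3 <- Δ t) (h2 ⋅ S h1 ⋅ a) ⊗ h3).
  by apply: eq_tlift => h1 h2; rewrite /psi tliftE ?mul1r //; lin.
apply: (cancel_l (g := fun h => a ⊗ h)); [lin|lin|].
by move=> u v; apply: (act_Sop' hR hu (f := fun y => y ⊗ v)) => //; lin.
Qed.

End Phi.

(** * The monomorphism *)

Theorem proposition3p8 (k : fieldType) (hk : [pchar k] =i pred0)
    (H : falgType k) (HH : hopf H) (hss : semisimple H)
    (R : H ⊗ H) (hR : quasitriangular HH R)
    (A : falgType k) (M : module_algebra HH A)
    (hqc : quantum_commutative R M)
    (x : A ⊗ A) (hx : symmetric_separability_idempotent x)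
    (alpha : dual A) (halpha : \tens_(x1, x2 <- x) ⟪alpha, x1⟫ *: x2 = 1)
    (hu : forall a : A, act M (drinfeld HH R) a = a) :
  whopf_monomorphism (smash R M x alpha) (B R M x alpha) (phi M x alpha).
Proof.
split; last exact: (phi_inj hR hx halpha hu).
split.
- exact: phi_lin.
- exact: (phi_mul hR hx halpha hu).
- exact: phi_one.
- exact: (phi_comul hR hqc hx halpha hu).
- exact: (phi_counit hR hx halpha hu).
- exact: (phi_anti hR hqc hx halpha hu).
Qed.
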